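(* Consider the setting, the estimator $\hat\theta_{\nu,T}$ and the set $\Theta_*$ described in the context, and write $E_*$ for expectation under $\bar P_*^\nu$. Suppose the following. (1) There is a continuous function $\underline q:\mathbb X\to\mathbb R_+\setminus\{0\}$ such that $Q(x,s,s')\ge \underline q(x)$ for all $Q\in\{Q_\theta:\theta\in\Theta\}\cup\{Q_*\}$ and all $(s',s,x)\in\mathbb S^2\times\mathbb X$. (2) There are constants $\lambda'\in(0,1)$, $\gamma\in(0,1)$, $b'>0$, $R>2b'/(1-\gamma)$, a lower semicontinuous function $\mathcal U:\mathbb X\to[1,\infty)$ and $\varpi\in\mathcal P(\mathbb X)$ such that, with $A=\{x\in\mathbb X:\mathcal U(x)\le R\}$, for all $s\in\mathbb S$: (i) $\int_{\mathbb X}\mathcal U(x')P_*(x,s,dx')\le\gamma\,\mathcal U(x)+b'1\{x\in A\}$ for all $x\in\mathbb X$; (ii) $A$ is bounded and $\varpi(A)>0$; (iii) $\inf_{x\in A}P_*(x,s,C)\ge\lambda'\varpi(C)$ for every Borel set $C\subseteq\mathbb X$. (3) $\Theta$ is compact, and $H^*$ exists and is lower semicontinuous. (4) (i) For any $\epsilon>0$ there is $\delta>0$ such that $$\max_{\dot\theta\in\Theta}E_*\Big[\sup_{\theta\in B(\delta,\dot\theta)}\frac{p^\nu(X_0\mid X_{-\infty}^{-1},\theta)}{p^\nu(X_0\mid X_{-\infty}^{-1},\dot\theta)}\Big]\le 1+\epsilon;$$ (ii) there is a function $C:\mathbb X\times\mathbb X\to\mathbb R_+$ such that, $\bar P_*^\nu$-a.s.,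 $\sup_{\theta\in\Theta}\frac{\max_{s}p_\theta(X_0,s,X_1)}{\min_{s}p_\theta(X_0,s,X_1)}\le C(X_0,X_1)$ and $\frac{\max_{s}p_*(X_0,s,X_1)}{\min_{s}p_*(X_0,s,X_1)}\le C(X_0,X_1)$ (max and min over $s\in\mathbb S$). (5) $T^{-1}\sum_{t=1}^T\max\{1,C(X_{t-1},X_t)\}\prod_{i=0}^{t-1}(1-\underline q(X_i))=o_{\bar P_*^\nu}(1)$ as $T\to\infty$. Then $d_\Theta(\hat\theta_{\nu,T},\Theta_* )=o_{\bar P_*^\nu}(1)$ as $T\to\infty$.
   Context: Setting. $\mathbb S=\{s_1,\dots,s_{|\mathbb S|}\}\subset\mathbb R$ is finite, $\mathbb X\subseteq\mathbb R^h$, $\mathcal P(\mathbb V)$ is the set of Borel probability measures on $\mathbb V$, and $V_a^b=(V_a,\dots,V_b)$. The process $(X_t,S_t)_{t\ge0}$ takes values in $\mathbb X\times\mathbb S$ ($X_t$ observed, $S_t$ hidden). Its true transition kernels are $P_*(x,s,\cdot)\in\mathcal P(\mathbb X)$ and $Q_*(x,s,\cdot)\in\mathcal P(\mathbb S)$: for $t\ge1$, $X_t\mid(X_0^{t-1},S_0^t)\sim P_*(X_{t-1},S_t,\cdot)$ and $S_t\mid(X_0^{t-1},S_0^{t-1})\sim Q_*(X_{t-1},S_{t-1},\cdot)$. $P_*(x,s,\cdot)$ has a density $p_*(x,s,\cdot)$ with respect to a fixed $\sigma$-finite measure on $\mathbb X$. The model is a family of kernels $(P_\theta,Q_\theta)_{\theta\in\Theta}$,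 $\Theta\subseteq\mathbb R^q$, of the same type, $P_\theta(x,s,\cdot)$ having density $p_\theta(x,s,\cdot)$ with respect to the same measure; it need not contain $(P_*,Q_* )$. $Q(x,s,s')$ denotes the mass $Q(x,s,\cdot)$ gives to $s'$. Stationary law. $\nu$ denotes the invariant distribution on $\mathbb X\times\mathbb S$ of the true joint chain $(X_t,S_t)$, for which $(X_t)$ is stationary and ergodic (it exists under hypotheses (1)-(2) of the claim), and $\bar P_*^\nu$ is the law of the two-sided stationary extension $(X_t,S_t)_{t\in\mathbb Z}$. Conditional densities. For integers $m\le t-1$, $p_t^\nu(X_t\mid X_m^{t-1},\theta)$ is the conditional density of $X_t$ given $X_m^{t-1}$ when $(X_m,S_m)\sim\nu$ and the process then evolves according to $(P_\theta,Q_\theta)$; that is, $p_t^\nu(X_t\mid X_m^{t-1},\theta)=L_{m,t}(\theta)/L_{m,t-1}(\theta)$ with $L_{m,k}(\theta)=\sum_{s_m,\dots,s_k\in\mathbb S}\nu(s_m|X_m)\prod_{j=m+1}^kQ_\theta(X_{j-1},s_{j-1},s_j)\,p_\theta(X_{j-1},s_j,X_j)$, where $\nu(\cdot|x)$ is the conditional law of $S$ given $X=x$ under $\nu$. Further $p^\nu(X_t\mid X_{-\infty}^{t-1},\theta)=\liminf_{M\to\infty}p_t^\nu(X_t\mid X_{-M}^{t-1},\theta)$; $p_*^\nu(X_t\mid X_{-\infty}^{t-1})$ is defined in the same way from $(P_*,Q_* )$. Criterion and estimator. $\ell_T^\nu(X_0^T,\theta)=T^{-1}\sum_{t=1}^T\log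 p_t^\nu(X_t\mid X_0^{t-1},\theta)$. $\hat\theta_{\nu,T}\in\Theta$ is any estimator with $\ell_T^\nu(X_0^T,\hat\theta_{\nu,T})\ge\sup_{\theta\in\Theta}\ell_T^\nu(X_0^T,\theta)-\eta_T$, where $\eta_T\ge0$ and $\eta_T=o(1)$. $H^*(\theta)=E_*\big[\log\frac{p_*^\nu(X_0\mid X_{-\infty}^{-1})}{p^\nu(X_0\mid X_{-\infty}^{-1},\theta)}\big]\in\mathbb R_+\cup\{\infty\}$ and $\Theta_*=\arg\min_{\theta\in\Theta}H^*(\theta)$. $B(\delta,\dot\theta)=\{\theta\in\Theta:\|\dot\theta-\theta\|<\delta\}$, $d_\Theta(\theta,A)=\inf_{\dot\theta\in A}\|\theta-\dot\theta\|$. *)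

(* Defs.v *)
From HB Require Import structures.
From mathcomp Require Import all_boot all_order all_algebra finmap.
From mathcomp Require Import all_classical all_reals all_analysis.
From mathcomp Require Import measurable_realfun.

Set Implicit Arguments.
Unset Strict Implicit.
Unset Printing Implicit Defensive.

Import Order.TTheory GRing.Theory Num.Theory.
Import numFieldNormedType.Exports.

Local Open Scope classical_set_scope.
Local Open Scope ring_scope.

Definition euclid_norm (R : realType) (n : nat) (x : 'rV[R]_n) : R :=
  Num.sqrt (\sum_(i < n) x ord0 i ^+ 2).

(** The subset [X] of R^h with its subspace topology and the Borel
    sigma-algebra of that topology.  Measurable types are pointed, hence the
    witness [x0] that [X] is nonempty. *)
Definition obs (R : realType) (h : nat) (X : set 'rV[R]_h) (x0 : X) : Type := X.

Section obs_instances.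
Context (R : realType) (h : nat) (X : set 'rV[R]_h) (x0 : X).

HB.instance Definition _ := Topological.copy (obs x0) (set_type X).
HB.instance Definition _ := isPointed.Build (obs x0) x0.

Let obsC (B : set (obs x0)) : <<s open >> B -> <<s open >> (~` B).
Proof. exact: sigma_algebraC. Qed.

HB.instance Definition _ := @isMeasurable.Build default_measure_display
  (obs x0) <<s open >> (@sigma_algebra0 _ setT open) obsC
  (@sigma_algebra_bigcup _ setT open).

End obs_instances.

(** The finite set [S] of reals, with the discrete sigma-algebra; [s0] witnesses
    that [S] is nonempty. *)
Definition hid (R : realType) (S : {fset R}) (s0 : S) : Type := S.

Section hid_instances.
Context (R : realType) (S : {fset R}) (s0 : S).

HB.instance Definition _ := Finite.copy (hid s0) (fset_sub_type S).
HB.instance Definition _ := isPointed.Build (hid s0) s0.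
HB.instance Definition _ := @isMeasurable.Build default_measure_display
  (hid s0) discrete_measurable discrete_measurable0
  discrete_measurableC discrete_measurableU.

End hid_instances.

Definition cylinders d (T : measurableType d) : set (set (int -> T)) :=
  [set C | exists t B, measurable B /\ C = [set w | B (w t)]].

(** Two-sided sequences in [T], with the product sigma-algebra. *)
Definition paths d (T : measurableType d) := g_sigma_algebraType (@cylinders d T).

Definition shift (T : Type) (w : int -> T) : int -> T := fun t => w (t + 1).

Section processes.
Context (R : realType) d (Om : measurableType d) (P : probability Om R).
Local Open Scope ereal_scope.

Definition stationary_process d' (T : measurableType d') (Y : int -> Om -> T) :=
  forall C : set (paths T), measurable C ->
    P [set w | C (shift (Y^~ w))] = P [set w | C (Y^~ w)].

Definition ergodic_process d' (T : measurableType d') (Y : int -> Om -> T) :=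
  forall C : set (paths T), measurable C -> (@shift T) @^-1` C = C ->
    P [set w | C (Y^~ w)] = 0 \/ P [set w | C (Y^~ w)] = 1.

(** The conditional law of [Y] given the sub-sigma-algebra [G] is the random
    measure [k]. *)
Definition cond_law d' (T : measurableType d') (G : set (set Om)) (Y : Om -> T)
    (k : Om -> set T -> \bar R) :=
  forall E B, G E -> measurable B ->
    P (E `&` Y @^-1` B) = \int[P]_(w in E) k w B.

(** [Z n = o_P(1)].  The outer probability [mu_ext P] coincides with [P] on
    measurable events; it is used because [Z n] may fail to be measurable (no
    measurability is imposed on estimators). *)
Definition oP1 (Z : nat -> Om -> \bar R) :=
  forall eps : R, (0 < eps)%R ->
    (fun n => mu_ext P [set w | eps%:E < `|Z n w|]) @ \oo --> 0.

End processes.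

Section regime_switching.
Context (R : realType) (h : nat) (X : set 'rV[R]_h) (x0 : X).
Context (S : {fset R}) (s0 : S).
Local Notation XX := (obs x0).
Local Notation SS := (hid s0).

(** Regime-switching models: [(PK, QK)] are the kernels of [X_t] given
    [(X_(t-1), S_t)] and of [S_t] given [(X_(t-1), S_(t-1))]. *)
Implicit Types (PK : R.-pker (XX * SS) ~> XX) (QK : R.-pker (XX * SS) ~> SS).
Implicit Types (p : XX -> SS -> XX -> R) (nuS : XX -> SS -> R).
Implicit Types (nu : probability (XX * SS)%type R).
Implicit Types (Pbar : probability (paths (XX * SS)%type) R).

Definition qmass QK (x : XX) (s s' : SS) : R := fine (QK (x, s) [set s']).

Definition has_density (mu : {sigma_finite_measure set XX -> \bar R}) PK p :=
  [/\ forall x s y, 0 <= p x s y,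
      forall s, measurable_fun setT (fun z : XX * XX => p z.1 s z.2) &
      forall x s B, measurable B ->
        PK (x, s) B = (\int[mu]_(y in B) (p x s y)%:E)%E].

(** Invariance under the one-step transition of [(X_t, S_t)]: first
    [S_t ~ QK (X_(t-1), S_(t-1))], then [X_t ~ PK (X_(t-1), S_t)]. *)
Definition invariant_law PK QK nu :=
  forall C : set (XX * SS), measurable C ->
    (nu C = \int[nu]_z \sum_(s' : SS)
              (QK z [set s'] * PK (z.1, s') [set x' | C (x', s')]))%E.

(** [nuS x] is a version of the conditional law of [S] given [X = x]. *)
Definition cond_state_law nu nuS :=
  [/\ forall x s, 0 <= nuS x s,
      forall x, \sum_(s : SS) nuS x s = 1,
      forall s, measurable_fun setT (nuS^~ s) &
      forall (B : set XX) s, measurable B ->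
        nu (B `*` [set s]) = (\int[nu]_(z in B `*` setT) (nuS z.1 s)%:E)%E].

Definition Xc (t : int) (w : paths (XX * SS)%type) : XX := (w t).1.
Definition Sc (t : int) (w : paths (XX * SS)%type) : SS := (w t).2.

(** [hist a b] is the sigma-algebra generated by the [X_i] with [i <= a] and the
    [S_i] with [i <= b]. *)
Definition hist (a b : int) : set (set (paths (XX * SS)%type)) :=
  <<s [set E | exists i B, [/\ i <= a, measurable B & E = Xc i @^-1` B]] `|`
      [set E | exists i B, [/\ i <= b, measurable B & E = Sc i @^-1` B]] >>.

(** [Pbar] is the law of the two-sided stationary process with transition
    kernels [(PK, QK)] and marginal law [nu]; its first component is ergodic. *)
Definition two_sided_law PK QK nu Pbar :=
  [/\ stationary_process Pbar (fun t (w : paths (XX * SS)%type) => w t),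
      ergodic_process Pbar Xc,
      forall C : set (XX * SS), measurable C -> Pbar [set w | C (w 0)] = nu C,
      forall t, cond_law Pbar (hist (t - 1) t) (Xc t)
                  (fun w => PK (Xc (t - 1) w, Sc t w)) &
      forall t, cond_law Pbar (hist (t - 1) (t - 1)) (Sc t)
                  (fun w => QK (Xc (t - 1) w, Sc (t - 1) w))].

(** [L_{m,k}] along the trajectory [x], for [m <= k]; the sum is over the hidden
    trajectories [s_m, ..., s_k], with [s_(m + j)] encoded as [s j]. *)
Definition likelihood nuS QK p (x : int -> XX) (m k : int) : R :=
  \sum_(s : {ffun 'I_(`|k - m|%N.+1) -> SS})
    nuS (x m) (s ord0) *
    \prod_(j < `|k - m|%N)
      (qmass QK (x (m + j%:Z)) (s (widen_ord (leqnSn _) j)) (s (lift ord0 j)) *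
       p (x (m + j%:Z)) (s (lift ord0 j)) (x (m + j%:Z + 1))).

(** [p_t(x_t | x_m^(t-1))], for [m <= t - 1]. *)
Definition cdens nuS QK p (x : int -> XX) (m t : int) : R :=
  likelihood nuS QK p x m t / likelihood nuS QK p x m (t - 1).

(** [p(x_t | x_(-oo)^(t-1))]. *)
Definition cdens_inf nuS QK p (x : int -> XX) (t : int) : \bar R :=
  limn_einf (fun M : nat => (cdens nuS QK p x (- M%:Z) t)%:E).

(** The normalized log-likelihood, with [log 0 = -oo]. *)
Definition loglik nuS QK p (x : int -> XX) (T : nat) : \bar R :=
  ((T%:R^-1)%:E *
   \sum_(1 <= t < T.+1) lne (cdens nuS QK p x 0 t%:Z)%:E)%E.

Definition max_dens p (x y : XX) : R :=
  \big[Num.max/p x s0 y]_(s : SS) p x s y.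

Definition min_dens p (x y : XX) : R :=
  \big[Num.min/p x s0 y]_(s : SS) p x s y.

(** [max_s p / min_s p]; the ratio is [+oo] when the denominator vanishes, also
    if the numerator does (unlike the library's [0 / 0 = 0]). *)
Definition dens_ratio p (x y : XX) : \bar R :=
  if min_dens p x y == 0 then +oo%E
  else (max_dens p x y / min_dens p x y)%:E.

Section model.
Context (q : nat) (Theta : set 'rV[R]_q).
Implicit Types (QM : Theta -> R.-pker (XX * SS) ~> SS).
Implicit Types (pM : Theta -> XX -> SS -> XX -> R).

Definition log_ratio nuS QK p QM pM (th : Theta) (w : paths (XX * SS)%type) :
    \bar R :=
  lne (cdens_inf nuS QK p (Xc^~ w) 0 / cdens_inf nuS (QM th) (pM th) (Xc^~ w) 0)%E.

Definition Hstar Pbar nuS QK p QM pM (th : Theta) : \bar R :=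
  (\int[Pbar]_w log_ratio nuS QK p QM pM th w)%E.

(** The integral defining [Hstar] is meaningful, with value in ]-oo, +oo]. *)
Definition Hstar_exists Pbar nuS QK p QM pM :=
  forall th : Theta,
    measurable_fun setT (log_ratio nuS QK p QM pM th) /\
    (\int[Pbar]_w ((log_ratio nuS QK p QM pM th)^\- w) < +oo)%E.

Definition argmin (H : Theta -> \bar R) : set Theta :=
  [set th | forall th', (H th <= H th')%E].

Definition Theta_ball (delta : R) (th0 : Theta) : set Theta :=
  [set th | euclid_norm (val th0 - val th) < delta].

Definition Theta_dist (th : Theta) (A : set Theta) : \bar R :=
  ereal_inf [set (euclid_norm (val th - val th'))%:E | th' in A].

Definition sup_ratio nuS QM pM (delta : R) (th0 : Theta)
    (w : paths (XX * SS)%type) : \bar R :=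
  ereal_sup [set (cdens_inf nuS (QM th) (pM th) (Xc^~ w) 0 /
                  cdens_inf nuS (QM th0) (pM th0) (Xc^~ w) 0)%E
            | th in Theta_ball delta th0].

(** An estimator maps the data [X_0, ..., X_T] to a parameter. *)
Definition estimator := forall T : nat, ('I_T.+1 -> XX) -> Theta.

Definition estimate (that : estimator) (T : nat) (w : paths (XX * SS)%type) :
    Theta :=
  that T (fun i => Xc (i : nat)%:Z w).

Definition approx_maximizer Pbar nuS QM pM (eta : nat -> R) (that : estimator) :=
  forall T, (0 < T)%N -> {ae Pbar, forall w,
    (ereal_sup [set loglik nuS (QM th) (pM th) (Xc^~ w) T | th in [set: Theta]]
       - (eta T)%:E
     <= loglik nuS (QM (estimate that T w)) (pM (estimate that T w))
          (Xc^~ w) T)%E}.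

End model.

End regime_switching.

(* Main.v *)
Require Import Defs.
From HB Require Import structures.
From mathcomp Require Import all_boot all_order all_algebra finmap.
From mathcomp Require Import all_classical all_reals all_analysis.
From mathcomp Require Import measurable_realfun.
From mathcomp Require Import ring lra.

Set Implicit Arguments.
Unset Strict Implicit.
Unset Printing Implicit Defensive.

Import Order.TTheory GRing.Theory Num.Theory.
Import numFieldNormedType.Exports.

Local Open Scope classical_set_scope.
Local Open Scope ring_scope.

(** The argument is Wald's consistency proof, carried by two facts about the
    predictive densities.

    Forgetting.  Write the likelihood of [x_m, ..., x_t] as a sum, over the
    hidden state at time [0], of a past weight times the weight [backward] of the
    future.  The predictive density of [x_t] is then an average, over that
    state, of ratios of [backward] weights, and only the averaging weights depend
    on the past.  One step of the hidden chain shrinks the range of these ratios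
    by the factor [1 - qlow], because every transition has mass at least [qlow]
    ([ratio_contraction]).  So the densities of [x_t] given [x_m, ..., x_(t-1)],
    for all [m <= 0] at once, lie between two bounds with
    [hi / lo <= 1 + C * \prod_(i < t) (1 - qlow x_i)] ([cdens_bracket]).  The
    inferior limit over [m] lies there too, hence replacing [log p_t(x_t | x_0,
    ..., x_(t-1))] by its stationary version costs, in the normalized
    log-likelihood, at most the average of the mixing assumption, uniformly in
    the parameter.

    Ergodicity.  Fix [th0] outside the argmin and [ths] in it.  For parameters
    in a small ball around [th0], the stationary log-likelihood ratio to [ths] at
    time [t] is bounded by one functional, evaluated at the path shifted by [t]:
    [sup_ratio - 1], by [ln x <= x - 1], minus a truncation of the log ratio at
    [th0], plus the log ratio at [ths].  Up to a small constant this is the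
    [contrast].  The truncation makes it integrable, and its mean is negative
    because [Hstar ths < Hstar th0] ([exists_contrast]).  Only a one-sided law of large numbers is needed:
    partial sums of a stationary ergodic sequence with negative mean are almost
    surely bounded above.  Indeed, by Garsia's argument ([maximal_ergodic]), the
    functional has a nonnegative integral over the invariant event that the
    partial sums are unbounded, so this event cannot have probability one.

    So near [th0] the likelihood eventually falls below that at [ths] by a fixed
    amount, and the outer probability that an approximate maximizer is in
    the ball tends to zero ([estimator_avoids]).  Finitely many such balls, together with
    small balls around points of the argmin, cover the compact parameter space. *)

(** * Contraction of ratios of backward weights *)

Section forgetting.
Context (R : realFieldType) (I : finType).

(** The [i]-th ratio is the average of [a / b] with weights [Q i j * g j * b j].
    As [e <= Q <= 1], these weights, once normalized, dominate [e] times the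
    normalized weights [g j * b j], which do not depend on [i]: all the averages
    share a component [e * rho], whence the factor [1 - e].  Bounds are written
    [lo * b <= a] rather than on a quotient, so that [b] may vanish. *)
Lemma ratio_contraction (Q : I -> I -> R) (g a b : I -> R) (e lo hi : R) :
  0 <= e -> (forall i j, e <= Q i j <= 1) -> (forall j, 0 <= g j) ->
  (forall j, 0 <= b j) -> 0 < \sum_j g j * b j ->
  (forall j, lo * b j <= a j <= hi * b j) ->
  exists lo' hi', [/\ lo <= lo', hi' - lo' = (1 - e) * (hi - lo) &
    forall i, lo' * (\sum_j Q i j * g j * b j) <= \sum_j Q i j * g j * a j
              <= hi' * (\sum_j Q i j * g j * b j)].
Proof.
move=> e0 Qe g0 b0 G0 ab.
set G := \sum_j g j * b j in G0 *.
set rho := (\sum_j g j * a j) / G.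
have rhoG : rho * G = \sum_j g j * a j by rewrite divfK// gt_eqF.
have lo_rho : lo <= rho.
  rewrite ler_pdivlMr// mulr_sumr ler_sum// => j _.
  by rewrite mulrCA ler_wpM2l//; case/andP: (ab j).
have rho_hi : rho <= hi.
  rewrite ler_pdivrMr// mulr_sumr ler_sum// => j _.
  by rewrite mulrCA ler_wpM2l//; case/andP: (ab j).
have QG i : \sum_j Q i j * g j * b j <= G.
  apply: ler_sum => j _; rewrite -mulrA ler_piMl ?mulr_ge0//.
  by case/andP: (Qe i j).
exists (lo + e * (rho - lo)), (hi - e * (hi - rho)); split.
- by rewrite lerDl mulr_ge0// subr_ge0.
- ring.
move=> i; set B := \sum_j Q i j * g j * b j; set A := \sum_j _ * a j.
have lower : e * (rho - lo) * G <= A - lo * B.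
  have -> : e * (rho - lo) * G = \sum_j e * (g j * (a j - lo * b j)).
    rewrite -mulr_sumr -mulrA mulrBl rhoG /G [lo * _]mulr_sumr -sumrB.
    by congr (e * _); apply: eq_bigr => j _; ring.
  have -> : A - lo * B = \sum_j Q i j * (g j * (a j - lo * b j)).
    by rewrite mulr_sumr -sumrB; apply: eq_bigr => j _; ring.
  apply: ler_sum => j _; apply: ler_wpM2r; last by case/andP: (Qe i j).
  by rewrite mulr_ge0// subr_ge0; case/andP: (ab j).
have upper : e * (hi - rho) * G <= hi * B - A.
  have -> : e * (hi - rho) * G = \sum_j e * (g j * (hi * b j - a j)).
    rewrite -mulr_sumr -mulrA mulrBl rhoG /G [hi * _]mulr_sumr -sumrB.
    by congr (e * _); apply: eq_bigr => j _; ring.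
  have -> : hi * B - A = \sum_j Q i j * (g j * (hi * b j - a j)).
    by rewrite mulr_sumr -sumrB; apply: eq_bigr => j _; ring.
  apply: ler_sum => j _; apply: ler_wpM2r; last by case/andP: (Qe i j).
  by rewrite mulr_ge0// subr_ge0; case/andP: (ab j).
have := QG i; rewrite -/B => BG.
have B1 : e * (rho - lo) * B <= e * (rho - lo) * G.
  by rewrite ler_wpM2l// mulr_ge0// subr_ge0.
have B2 : e * (hi - rho) * B <= e * (hi - rho) * G.
  by rewrite ler_wpM2l// mulr_ge0// subr_ge0.
by apply/andP; split; lra.
Qed.

Context (X : Type) (Q : X -> I -> I -> R) (p : X -> I -> X -> R).
Implicit Types x : nat -> X.

(** Likelihood of [x 1, ..., x n] given [x 0] and the hidden state [s] at time
    [0]: the backward variable of the forward-backward algorithm. *)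
Fixpoint backward x (n : nat) (s : I) : R :=
  if n is n'.+1 then
    \sum_s' Q (x 0%N) s s' * p (x 0%N) s' (x 1%N) * backward (fun i => x i.+1) n' s'
  else 1.

Definition lik_from (a : I -> R) x n : R := \sum_s a s * backward x n s.

(** The past before time [d] enters the later likelihoods only through a vector
    of nonnegative weights on the hidden state at time [d]. *)
Lemma lik_from_restart d x (a : I -> R) : (forall y i j, 0 <= Q y i j) ->
    (forall i s, 0 <= p (x i) s (x i.+1)) -> (forall s, 0 <= a s) ->
  exists2 a' : I -> R, forall s, 0 <= a' s &
    forall n, lik_from a x (d + n) = lik_from a' (fun i => x (d + i)%N) n.
Proof.
move=> Q0; elim: d x a => [|d IH] x a p0 a0; first by exists a.
have [||a' a'0 a'E] := IH (fun i => x i.+1)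
  (fun s' => \sum_s a s * (Q (x 0%N) s s' * p (x 0%N) s' (x 1%N))).
- by move=> i s; exact: p0.
- by move=> s'; apply: sumr_ge0 => s _; rewrite !mulr_ge0.
exists a' => // n; rewrite -[RHS]a'E /lik_from addSn /=.
under eq_bigr do rewrite mulr_sumr.
rewrite exchange_big; apply: eq_bigr => s' _.
by rewrite mulr_suml; apply: eq_bigr => s _; rewrite !mulrA.
Qed.

Context (q : X -> R).
Hypotheses (q_gt0 : forall y, 0 < q y) (q_le : forall y i j, q y <= Q y i j).
Hypothesis Q_sum1 : forall y i, \sum_j Q y i j = 1.

Let Q_le1 y i j : Q y i j <= 1.
Proof.
rewrite -(Q_sum1 y i) (bigD1 j)//= lerDl sumr_ge0// => k _.
exact: le_trans (ltW (q_gt0 y)) (q_le y i k).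
Qed.

Lemma backward_gt0 x n s0 : (forall i s, 0 < p (x i) s (x i.+1)) -> 0 < backward x n s0.
Proof.
elim: n x s0 => [|n IH] x s0 p0 //=.
have F0 s' : 0 < Q (x 0%N) s0 s' * p (x 0%N) s' (x 1%N) * backward (fun i => x i.+1) n s'.
  have Q0 : 0 < Q (x 0%N) s0 s' by exact: lt_le_trans (q_gt0 _) (q_le _ _ _).
  by rewrite mulr_gt0 ?IH ?mulr_gt0// => i s; exact: p0.
by rewrite (bigD1 s0)//=; apply: ltr_pwDl => //; apply: sumr_ge0 => i _; exact: ltW.
Qed.

(** For [n = 0] the ratios are averages of the emission densities [p] at time
    [1], so they range between [m] and [M]; each earlier time applies
    [ratio_contraction] once more, with [g] the emission density. *)
Lemma backward_bracket x n (m M : R) :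
  (forall i s, 0 < p (x i) s (x i.+1)) ->
  (forall s, m <= p (x n) s (x n.+1) <= M) ->
  exists lo hi, [/\ m <= lo,
    hi - lo = (\prod_(0 <= i < n.+1) (1 - q (x i))) * (M - m) &
    forall s, lo * backward x n s <= backward x n.+1 s <= hi * backward x n s].
Proof.
have qQ y i j : q y <= Q y i j <= 1 by rewrite q_le Q_le1.
case: (pickP (fun _ : I => true)) => [i0 _|I0]; last first.
  move=> _ _; exists m, (m + (\prod_(0 <= i < n.+1) (1 - q (x i))) * (M - m)).
  by split=> [//||s]; [ring|have := I0 s].
elim: n x => [|n IH] x p0 mM.
  have g1 : forall j : I, 0 <= (fun=> 1 : R) j by [].
  have G0 : 0 < \sum_(j : I) (1 * 1 : R).
    by rewrite mulr1 (bigD1 i0)//= ltr_pwDl// sumr_ge0.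
  have ab j : m * 1 <= p (x 0%N) j (x 1%N) <= M * 1 by rewrite !mulr1.
  have [lo [hi [mlo E B]]] :=
    ratio_contraction (ltW (q_gt0 (x 0%N))) (qQ _) g1 g1 G0 ab.
  exists lo, hi; split => //; first by rewrite big_nat1.
  move=> s; have := B s.
  under eq_bigr do rewrite !mulr1.
  rewrite Q_sum1 /=.
  under [X in _ <= X <= _]eq_bigr do rewrite mulr1.
  by under [X in _ -> _ <= X <= _]eq_bigr do rewrite mulr1.
have [|//|lo [hi [mlo E B]]] := IH (fun i => x i.+1); first by move=> i s; exact: p0.
have b0 j : 0 < backward (fun i => x i.+1) n j by apply: backward_gt0 => i s; exact: p0.
have G0 : 0 < \sum_j p (x 0%N) j (x 1%N) * backward (fun i => x i.+1) n j.
  rewrite (bigD1 i0)//= ltr_pwDl ?mulr_gt0// sumr_ge0// => j _.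
  by rewrite ltW// mulr_gt0.
have [lo' [hi' [lolo' E' B']]] := ratio_contraction (ltW (q_gt0 (x 0%N))) (qQ _)
  (fun j => ltW (p0 0%N j)) (fun j => ltW (b0 j)) G0 B.
exists lo', hi'; split => //; first exact: le_trans lolo'.
by rewrite E' E [in RHS]big_nat_recl// mulrA.
Qed.

End forgetting.

(** * Predictive densities and forgetting *)

Section trajectories.
Context (R : realFieldType) (I : finType).

Definition traj_cons n (i : I) (s : {ffun 'I_n -> I}) : {ffun 'I_n.+1 -> I} :=
  [ffun k => if unlift ord0 k is Some j then s j else i].

Lemma sum_traj_cons n (F : {ffun 'I_n.+1 -> I} -> R) :
  \sum_s F s = \sum_i \sum_s F (traj_cons i s).
Proof.
rewrite pair_big (reindex (fun u : I * {ffun 'I_n -> I} => traj_cons u.1 u.2)) //=.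
exists (fun s => (s ord0, [ffun j => s (lift ord0 j)])) => [[i s] _|s _] /=.
  congr (_, _); first by rewrite ffunE unlift_none.
  by apply/ffunP => j; rewrite !ffunE liftK.
by apply/ffunP => k; rewrite ffunE; case: unliftP => [j ->|->]; rewrite ?ffunE.
Qed.

Context (X : Type) (Q : X -> I -> I -> R) (p : X -> I -> X -> R).

(** Summing over the first hidden state of a trajectory is one step of the
    recursion defining [backward]. *)
Lemma sum_trajectories (a : I -> R) (y : nat -> X) n :
  \sum_(s : {ffun 'I_n.+1 -> I}) a (s ord0) * \prod_(j < n)
    (Q (y j) (s (widen_ord (leqnSn _) j)) (s (lift ord0 j)) *
     p (y j) (s (lift ord0 j)) (y j.+1)) = lik_from Q p a y n.
Proof.
elim: n a y => [|n IH] a y; rewrite sum_traj_cons; apply: eq_bigr => i _ /=.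
  under eq_bigr do rewrite big_ord0 mulr1 ffunE unlift_none.
  by rewrite sumr_const card_ffun card_ord expn0 mulr1n mulr1.
have := IH (fun s' => Q (y 0%N) i s' * p (y 0%N) s' (y 1%N)) (fun j => y j.+1).
rewrite /lik_from => <-; rewrite mulr_sumr; apply: eq_bigr => s _.
rewrite ffunE unlift_none big_ord_recl; congr (a i * (_ * _)).
  have -> : widen_ord (leqnSn n.+1) ord0 = ord0 by exact/val_inj.
  by rewrite !ffunE unlift_none liftK.
apply: eq_bigr => j _.
have -> : widen_ord (leqnSn n.+1) (lift ord0 j) =
  lift ord0 (widen_ord (leqnSn n) j) by exact/val_inj.
by rewrite !ffunE !liftK.
Qed.

End trajectories.

Section densities.
Context (R : realType) (h : nat) (X : set 'rV[R]_h) (x0 : X).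
Context (S : {fset R}) (s0 : S).
Local Notation XX := (obs x0).
Local Notation SS := (hid s0).
Implicit Types (QK : R.-pker (XX * SS) ~> SS) (p : XX -> SS -> XX -> R).
Implicit Types (nuS : XX -> SS -> R).

Lemma likelihoodE nuS QK p (x : int -> XX) (m : int) (n : nat) :
  likelihood nuS QK p x m (m + n%:Z) =
  lik_from (qmass QK) p (nuS (x m)) (fun j => x (m + j%:Z)) n.
Proof.
rewrite -sum_trajectories /likelihood.
have -> : absz (m + n%:Z - m)%R = n by rewrite addrAC subrr add0r.
apply: eq_bigr => s _; congr (_ * _); apply: eq_bigr => j _.
by rewrite -addrA -PoszD addn1.
Qed.

Lemma qmass_sum1 QK y (s : SS) : \sum_(s' : SS) qmass QK y s s' = 1.
Proof.
apply: EFin_inj; rewrite -sumEFin -(@prob_kernel _ _ _ _ _ QK (y, s)).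
have -> : [set: SS] = \bigcup_(s' in [set` index_enum SS]) [set s'].
  by apply/seteqP; split=> // s' _; exists s' => //=; rewrite mem_index_enum.
rewrite measure_fin_bigcup//; last by move=> i j _ _ [k [/= -> ->]].
rewrite -fsbig_seq ?index_enum_uniq//; apply: eq_bigr => s' _; rewrite /qmass fineK//.
rewrite ge0_fin_numE//; apply: (@le_lt_trans _ _ (QK (y, s) setT)).
  by apply: le_measure; rewrite ?inE.
by rewrite prob_kernel ltry.
Qed.

Lemma le_max_dens p y z s : p y s z <= max_dens p y z.
Proof. exact: le_bigmax. Qed.

Lemma min_dens_le p y z s : min_dens p y z <= p y s z.
Proof. exact: bigmin_le. Qed.

Lemma dens_ratioP p y z (c : R) : (forall s, 0 <= p y s z) ->
  (dens_ratio p y z <= c%:E)%E ->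
  0 < min_dens p y z /\ max_dens p y z <= c * min_dens p y z.
Proof.
move=> p0; rewrite /dens_ratio; case: ifPn => [_|m0]; first by rewrite leye_eq.
rewrite lee_fin.
have m_gt0 : 0 < min_dens p y z.
  rewrite lt0r m0 /= /min_dens; elim/big_ind: _ => // a b a0 b0.
  by rewrite le_min a0.
by rewrite ler_pdivrMr.
Qed.

Context (q : XX -> R) (q_gt0 : forall y, 0 < q y).

(** The interval does not depend on how far back the conditioning goes: by
    [lik_from_restart] a longer past only changes the weights with which the
    ratios of [backward_bracket], started at time [0], are averaged. *)
Lemma cdens_bracket nuS QK p (x : int -> XX) (c : R) (n : nat) :
  (forall y s s', q y <= qmass QK y s s') ->
  (forall y s, 0 <= nuS y s) -> (forall y, \sum_(s : SS) nuS y s = 1) ->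
  (forall i s, 0 < p (x i) s (x (i + 1))) -> 0 <= c ->
  max_dens p (x n%:Z) (x n.+1%:Z) <= c * min_dens p (x n%:Z) (x n.+1%:Z) ->
  exists lo hi, [/\ 0 < lo,
    hi <= lo * (1 + c * \prod_(0 <= i < n.+1) (1 - q (x i%:Z))) &
    forall M : nat, lo <= cdens nuS QK p x (- M%:Z) n.+1%:Z <= hi].
Proof.
move=> qQ nu0 nu1 p0 c0 maxmin.
set m := min_dens _ _ _ in maxmin *; set Mx := max_dens _ _ _ in maxmin *.
have p0' i s : 0 < p (x i%:Z) s (x i.+1%:Z) by rewrite -addn1 PoszD p0.
have m_gt0 : 0 < m by rewrite /m /min_dens; elim/big_ind: _ => // a b a0 b0; rewrite lt_min a0.
have Q1 : forall y i, \sum_j qmass QK y i j = 1 by move=> y i; exact: qmass_sum1.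
have mMx s : m <= p (x n%:Z) s (x n.+1%:Z) <= Mx by rewrite min_dens_le le_max_dens.
have [lo [hi [mlo E B]]] :=
  @backward_bracket _ _ _ (qmass QK) p q q_gt0 qQ Q1 (fun j => x j%:Z) n m Mx p0' mMx.
have lo0 : 0 < lo by exact: lt_le_trans mlo.
exists lo, hi; split => //.
  have prod0 : 0 <= \prod_(0 <= i < n.+1) (1 - q (x i%:Z)).
    apply: prodr_ge0 => i _; rewrite subr_ge0.
    rewrite -(Q1 (x i%:Z) s0) (bigD1 s0)//=.
    apply: (le_trans (qQ (x i%:Z) s0 s0)); rewrite lerDl sumr_ge0// => s _.
    exact: le_trans (ltW (q_gt0 _)) (qQ _ _ _).
  rewrite mulrDr mulr1 -lerBlDl E mulrA [X in _ <= X]mulrC ler_wpM2l//.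
  have cm_clo : c * m <= c * lo by exact: ler_wpM2l.
  by rewrite mulrC; lra.
move=> M.
have posp i s : 0 < p (x (- M%:Z + i%:Z)) s (x (- M%:Z + i.+1%:Z)).
  by have := p0 (- M%:Z + i%:Z) s; rewrite -addrA -PoszD addn1.
have Q0 : forall y i j, 0 <= qmass QK y i j.
  by move=> y i j; exact: le_trans (ltW (q_gt0 y)) (qQ y i j).
(* a is the unnormalized filter at time 0 of the process started at - M. *)
have [a a0 aE] := @lik_from_restart R SS XX (qmass QK) p M
  (fun j => x (- M%:Z + j%:Z)) (nuS (x (- M%:Z))) Q0
  (fun i s => ltW (posp i s)) (nu0 _).
have L k : likelihood nuS QK p x (- M%:Z) k%:Z =
    lik_from (qmass QK) p a (fun j => x j%:Z) k.
  have -> : k%:Z = - M%:Z + (M + k)%N%:Z by rewrite PoszD addKr.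
  rewrite likelihoodE aE; congr (lik_from _ _ _ _ _).
  by apply/funext => j; rewrite PoszD addKr.
have L_gt0 k : 0 < lik_from (qmass QK) p a (fun j => x j%:Z) k.
  rewrite -L (_ : k%:Z = - M%:Z + (M + k)%N%:Z); last by rewrite PoszD addKr.
  rewrite likelihoodE /lik_from.
  have F0 s : 0 < backward (qmass QK) p (fun j => x (- M%:Z + j%:Z)) (M + k) s.
    exact: (@backward_gt0 _ _ _ (qmass QK) p q q_gt0 qQ).
  rewrite lt0r sumr_ge0 ?andbT//; last by move=> s _; rewrite mulr_ge0// ltW.
  apply/negP; rewrite psumr_eq0; last by move=> s _; rewrite mulr_ge0// ltW.
  move=> /allP nu_eq0; have := nu1 (x (- M%:Z)); rewrite big1 => [/esym/eqP|s _].
    by rewrite oner_eq0.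
  have /implyP/(_ isT) := nu_eq0 s (mem_index_enum s).
  by rewrite mulf_eq0 (gt_eqF (F0 s)) orbF => /eqP.
rewrite /cdens (_ : n.+1%:Z - 1 = n%:Z); last by rewrite -addn1 PoszD addrK.
rewrite !L ler_pdivlMr// ler_pdivrMr// /lik_from !mulr_sumr.
apply/andP; split; apply: ler_sum => s _; rewrite mulrCA ler_wpM2l//.
  by case/andP: (B s).
by case/andP: (B s).
Qed.

End densities.

Lemma limn_einf_bounds (R : realType) (u : (\bar R)^nat) (lo hi : \bar R) (N : nat) :
  (forall n, (N <= n)%N -> (lo <= u n <= hi)%E) -> (lo <= limn_einf u <= hi)%E.
Proof.
move=> uN; have ce : cvgn (einfs u) by exact: is_cvg_einfs.
rewrite limn_einf_lim; apply/andP; split.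
  apply: lime_ge => //; exists N => // n /= Nn.
  apply/le_ereal_inf_tmp => _ [k /= nk <-].
  by case/andP: (uN k (leq_trans Nn nk)).
apply: lime_le => //; exists N => // n /= Nn.
case/andP: (uN n Nn) => _; apply: le_trans; apply: ereal_inf_lbound.
by exists n => /=.
Qed.

Section densities.
Context (R : realType) (h : nat) (X : set 'rV[R]_h) (x0 : X).
Context (S : {fset R}) (s0 : S).
Local Notation XX := (obs x0).
Local Notation SS := (hid s0).
Context (nuS : XX -> SS -> R) (QK : R.-pker (XX * SS) ~> SS) (p : XX -> SS -> XX -> R).

Lemma likelihood_shift (x : int -> XX) (m k j : int) :
  likelihood nuS QK p (fun i => x (i + j)) m k = likelihood nuS QK p x (m + j) (k + j).
Proof.
rewrite /likelihood.
have -> : (k + j) - (m + j) = k - m by rewrite opprD addrACA subrr addr0.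
apply: eq_bigr => s _; congr (_ * _); apply: eq_bigr => i _.
by rewrite [m + j + _]addrAC [m + i%:Z + j + 1]addrAC.
Qed.

Lemma cdens_shift (x : int -> XX) (m k j : int) :
  cdens nuS QK p (fun i => x (i + j)) m k = cdens nuS QK p x (m + j) (k + j).
Proof. by rewrite /cdens !likelihood_shift [k - 1 + j]addrAC. Qed.

Context (q : XX -> R) (q_gt0 : forall y, 0 < q y).

(** Shifting time by [n.+1] turns the density of the present given the infinite
    past into that of [x n.+1]; its defining sequence runs over the starting
    times [n.+1 - M], which are nonpositive from [M = n.+1] on, so
    [cdens_bracket] bounds both densities by the same [lo] and [hi]. *)
Lemma cdens_inf_close (x : int -> XX) (c : R) (n : nat) :
  (forall y s s', q y <= qmass QK y s s') ->
  (forall y s, 0 <= nuS y s) -> (forall y, \sum_(s : SS) nuS y s = 1) ->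
  (forall i s, 0 < p (x i) s (x (i + 1))) -> 0 <= c ->
  max_dens p (x n%:Z) (x n.+1%:Z) <= c * min_dens p (x n%:Z) (x n.+1%:Z) ->
  0 < cdens nuS QK p x 0 n.+1%:Z /\ exists l : R,
    [/\ cdens_inf nuS QK p (fun i => x (i + n.+1%:Z)) 0 = l%:E, 0 < l &
        `|ln (cdens nuS QK p x 0 n.+1%:Z) - ln l| <=
          c * \prod_(0 <= i < n.+1) (1 - q (x i%:Z))].
Proof.
move=> qQ nu0 nu1 p0 c0 maxmin.
have [lo [hi [lo0 hilo B]]] := cdens_bracket q_gt0 qQ nu0 nu1 p0 c0 maxmin.
set d := c * _ in hilo *.
have /andP[lo0n hi0n] := B 0%N; rewrite oppr0 in lo0n hi0n.
have c_gt0 : 0 < cdens nuS QK p x 0 n.+1%:Z by exact: lt_le_trans lo0n.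
split=> //.
have /(@limn_einf_bounds _ _ _ _ n.+1) : forall M, (n.+1 <= M)%N ->
    (lo%:E <= (cdens nuS QK p (fun i => x (i + n.+1%:Z)) (- M%:Z) 0)%:E <= hi%:E)%E.
  move=> M nM; rewrite !lee_fin cdens_shift add0r.
  have -> : - M%:Z + n.+1%:Z = - (M - n.+1)%N%:Z.
    by rewrite -subzn// opprB addrC.
  exact: B.
rewrite -/(cdens_inf _ _ _ _ _).
case: (cdens_inf _ _ _ _ _) => [l||]; rewrite ?leye_eq ?leeNy_eq ?andbF//=.
rewrite !lee_fin => /andP[lol lhi].
have l0 : 0 < l by exact: lt_le_trans lol.
exists l; split=> //.
have hi0 : 0 < hi by exact: lt_le_trans lhi.
have lnhi : ln hi - ln lo <= d.
  rewrite -ln_div ?posrE//.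
  have hl : hi / lo <= 1 + d by rewrite ler_pdivrMr// mulrC.
  have hl0 : 0 < hi / lo by rewrite divr_gt0.
  have : 1 + (hi / lo - 1) = hi / lo by lra.
  move=> <-; apply: (@le_trans _ _ (hi / lo - 1)); last lra.
  by apply: le_ln1Dx; lra.
rewrite ler_norml.
have mono (a b : R) : 0 < a -> a <= b -> ln a <= ln b.
  by move=> a0 ab; rewrite ler_ln ?posrE// (lt_le_trans a0).
have := mono _ _ lo0 lo0n; have := mono _ _ c_gt0 hi0n.
have := mono _ _ lo0 lol; have := mono _ _ l0 lhi.
by move=> *; apply/andP; split; lra.
Qed.

End densities.

(** * A one-sided law of large numbers *)

Lemma natr_ub (R : realType) (x : R) : exists k : nat, x <= k%:R.
Proof.
exists (Num.bound `|x|); apply: le_trans (ler_norm x) _.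
exact/ltW/archi_boundP.
Qed.

Section maximal_ergodic.
Context d (Om : measurableType d) (R : realType) (P : probability Om R).
Context (T : Om -> Om) (mT : measurable_fun setT T).
Hypothesis PT : forall E, measurable E -> P (T @^-1` E) = P E.
Context (f : Om -> R) (mf : measurable_fun setT f).
Hypothesis intf : P.-integrable setT (EFin \o f).

(** [maxsum n w] is the maximum of the partial sums [f w + ... + f (T^(k-1) w)]
    for [0 <= k <= n]; this recursion is all that the maximal ergodic argument
    uses. *)
Fixpoint maxsum (n : nat) (w : Om) : R :=
  if n is n'.+1 then Num.max 0 (f w + maxsum n' (T w)) else 0.

Lemma maxsum_ge0 n w : 0 <= maxsum n w.
Proof. by case: n => //= n; rewrite le_max lexx. Qed.

Lemma maxsum_le n w : maxsum n w <= maxsum n.+1 w.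
Proof.
elim: n w => [|n IH] w; first exact: maxsum_ge0.
by rewrite [maxsum n.+1]/= [maxsum n.+2 w]/= ge_max !le_max lexx/= lerD2l IH orbT.
Qed.

Lemma maxsum_nd w : {homo maxsum^~ w : m n / (m <= n)%N >-> m <= n}.
Proof. by apply: homo_leq => [//|y x z|n]; [exact: le_trans|exact: maxsum_le]. Qed.

Lemma birkhoff_le_maxsum n w : \sum_(0 <= i < n) f (iter i T w) <= maxsum n w.
Proof.
elim: n w => [|n IH] w; first by rewrite big_nil.
rewrite big_nat_recl//= le_max; apply/orP; right; rewrite lerD2l.
rewrite (eq_bigr (fun i => f (iter i T (T w)))) => [|i _]; first exact: IH.
by rewrite -iterS iterSr.
Qed.

Lemma measurable_maxsum n : measurable_fun setT (maxsum n).
Proof.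
elim: n => [|n IH]; first exact: measurable_cst.
apply: measurable_maxr; first exact: measurable_cst.
by apply: measurable_funD => //; exact: (measurableT_comp IH).
Qed.

Lemma measurable_birkhoff (c : R) n :
  measurable [set w | c < \sum_(0 <= i < n) f (iter i T w)].
Proof.
rewrite -[X in measurable X]setTI.
apply: (measurable_fun_ltr (measurable_cst c)) => //.
apply: measurable_sum => i; apply: (measurableT_comp mf).
by elim: i => [|i IH]; [exact: measurable_id|exact: (measurableT_comp mT IH)].
Qed.

Definition unbounded_sums : set Om := [set w | forall N : nat, exists n, N%:R < maxsum n w].

Lemma unbounded_sumsE : unbounded_sums = \bigcap_N \bigcup_n [set w | N%:R < maxsum n w].
Proof.
apply/seteqP; split=> w /= H N; first by move=> _; have [n Nn] := H N; exists n.
by have [//|n _ Nn] := H N; exists n.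
Qed.

Lemma measurable_lt_maxsum (c : R) n : measurable [set w | c < maxsum n w].
Proof.
rewrite -[X in measurable X]setTI.
exact: (measurable_fun_ltr (measurable_cst c) (measurable_maxsum n)).
Qed.

Lemma measurable_unbounded : measurable unbounded_sums.
Proof.
rewrite unbounded_sumsE; apply: bigcapT_measurable => N; apply: bigcupT_measurable => n.
exact: measurable_lt_maxsum.
Qed.

(** Shifting changes the partial sums only by the finite amount [f w]. *)
Lemma unbounded_inv : T @^-1` unbounded_sums = unbounded_sums.
Proof.
apply/seteqP; split=> w /= H N.
  have [k Nk] := natr_ub (N%:R - f w); have [n kn] := H k.
  by exists n.+1 => /=; rewrite lt_max; apply/orP; right; lra.
have [k fk] := natr_ub (f w).
have [[|n] /=] := H (N + k)%N; first by rewrite ltNge ler0n.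
rewrite lt_max ltNge ler0n/= natrD => Nn; exists n; lra.
Qed.

Local Open Scope ereal_scope.

Lemma ge0_integral_comp D (g : Om -> \bar R) : measurable D ->
  measurable_fun setT g -> (forall w, 0 <= g w) ->
  \int[P]_(w in T @^-1` D) g (T w) = \int[P]_(w in D) g w.
Proof.
move=> mD mg g0.
rewrite -[LHS](@ge0_integral_pushforward _ _ _ _ _ T mT P D g)//; last first.
  exact: measurable_funTS.
by apply: eq_measure_integral => E mE _; exact: PT.
Qed.

Lemma integrable_comp (g : Om -> \bar R) :
  P.-integrable setT g -> P.-integrable setT (g \o T).
Proof.
case/integrableP => mg ig; apply/integrableP; split.
  exact: measurableT_comp mg mT.
have := @ge0_integral_comp setT (abse \o g) measurableT.
rewrite preimage_setT => E; rewrite [ltLHS]E //.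
  by apply: measurableT_comp => //; exact: measurable_abse.
by move=> w; exact: abse_ge0.
Qed.

Lemma integrable_maxsum n : P.-integrable setT (EFin \o maxsum n).
Proof.
elim: n => [|n IH]; first exact: (finite_measure_integrable_cst P 0%R).
have mM := measurable_maxsum n.
have iMT := integrable_comp IH.
apply: (le_integrable measurableT _ _ (integrableD measurableT (integrable_abse intf) iMT)).
  by apply/measurable_EFinP; exact: measurable_maxsum.
move=> w _ /=; rewrite lee_fin.
rewrite ger0_norm ?le_max ?lexx// ger0_norm ?addr_ge0 ?maxsum_ge0//.
by rewrite ge_max addr_ge0 ?maxsum_ge0//= lerD2r ler_norm.
Qed.

(** The increments [maxsum n.+1 - maxsum n \o T = max (- maxsum n \o T) f] are
    dominated by [`|f|] and tend to [f] where the sums are unbounded.  On an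
    invariant set [maxsum n \o T] and [maxsum n] have the same integral, so the
    increments integrate to something nonnegative by monotonicity of [maxsum]. *)
Lemma maximal_ergodic : 0 <= \int[P]_(w in unbounded_sums) (f w)%:E.
Proof.
pose A := unbounded_sums; have mA : measurable A := measurable_unbounded.
pose g n w := (maxsum n.+1 w - maxsum n (T w))%R.
have gE n w : g n w = Num.max (- maxsum n (T w))%R (f w).
  by rewrite /g /= addr_maxl sub0r addrK.
have mMT n : measurable_fun setT (maxsum n \o T).
  exact: (measurableT_comp (measurable_maxsum n)).
have mg n : measurable_fun setT (g n).
  by apply: measurable_funB; [exact: measurable_maxsum|exact: mMT].
have int_ge0 n : 0 <= \int[P]_(w in A) (g n w)%:E.
  have -> : \int[P]_(w in A) (g n w)%:E =
      \int[P]_(w in A) ((maxsum n.+1 w)%:E - (maxsum n (T w))%:E).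
    by apply: eq_integral.
  have iM k : P.-integrable A (EFin \o maxsum k).
    exact: integrableS (integrable_maxsum k).
  have iMT : P.-integrable A (EFin \o maxsum n \o T).
    by apply: (@integrableS _ _ _ P setT) => //; exact/integrable_comp/integrable_maxsum.
  have iE : \int[P]_(w in A) (maxsum n (T w))%:E = \int[P]_(w in A) (maxsum n w)%:E.
    have := @ge0_integral_comp A (EFin \o maxsum n) mA.
    rewrite unbounded_inv => <-//.
      by apply/measurable_EFinP; exact: measurable_maxsum.
    by move=> w; rewrite lee_fin maxsum_ge0.
  rewrite (integralB mA (iM n.+1) iMT) [X in _ - X]iE sube_ge0; last first.
    by rewrite (integrable_fin_num mA (iM n)).
  apply: ge0_le_integral => //.
  - by move=> w _; rewrite lee_fin maxsum_ge0.
  - by case/integrableP: (iM n).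
  - by case/integrableP: (iM n.+1).
  - by move=> w _; rewrite lee_fin maxsum_le.
have mgE n : measurable_fun A (fun w => (g n w)%:E).
  by apply: measurable_funTS; apply/measurable_EFinP; exact: mg.
have intA := integrableS measurableT mA (@subsetT _ A) intf.
have mfE : measurable_fun A (EFin \o f) by case/integrableP: intA.
have iabs : P.-integrable A (abse \o (EFin \o f)) by exact: integrable_abse.
have cvf : {ae P, forall w, A w -> (g n w)%:E @[n --> \oo] --> (EFin \o f) w}.
  apply/aeW => w Aw; apply: cvg_near_cst.
  have ATw : A (T w) by rewrite /A -unbounded_inv in Aw.
  have [k fk] := natr_ub (- f w)%R; have [N kN] := ATw k.
  exists N => // n /= Nn; rewrite gE max_r//.
  have := maxsum_nd (T w) Nn; lra.
have dom : {ae P, forall w n, A w -> `|(g n w)%:E| <= (abse \o (EFin \o f)) w}.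
  apply/aeW => w n _ /=; rewrite lee_fin gE.
  rewrite ler_norml le_max ge_max ler_norm !andbT lerNl.
  have := maxsum_ge0 n (T w); have := normr_ge0 (f w); have := ler_norm (- f w)%R.
  by rewrite normrN => *; apply/andP; split; [apply/orP; right; lra|lra].
have [_ _ cv] := dominated_convergence mA mgE mfE cvf iabs dom.
rewrite -(cvg_lim _ cv)//; apply: lime_ge; first exact: cvgP cv.
by apply: nearW => n; exact: int_ge0.
Qed.

(** Ergodicity is asked of the single invariant set that the proof meets.  A
    negative mean rules out that its probability is one; then the sums are
    almost surely bounded, and exceed [c * n] with vanishing probability. *)
Lemma weak_lln_lt0 (c : R) :
  P unbounded_sums = 0 \/ P unbounded_sums = 1 ->
  \int[P]_w (f w)%:E < 0 -> (0 < c)%R ->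
  P [set w | (c * n%:R < \sum_(0 <= i < n) f (iter i T w))%R] @[n --> \oo] --> 0.
Proof.
move=> A01 intf_lt0 c0.
have A0 : P unbounded_sums = 0.
  case: A01 => // A1.
  have := maximal_ergodic; rewrite leNgt => /negP[].
  have PC0 : P (~` unbounded_sums) = 0.
    by rewrite probability_setC ?A1 ?subee//; exact: measurable_unbounded.
  have mC := measurableC measurable_unbounded.
  by move: intf_lt0; rewrite (negligible_integral mC measurableT intf PC0) setTD setCK.
pose F N := \bigcup_n [set w | (c * N%:R < maxsum n w)%R].
have mF N : measurable (F N).
  by apply: bigcupT_measurable => n; exact: measurable_lt_maxsum.
(* The F N decrease to the null set where the sums are unbounded. *)
have FA : \bigcap_N F N = unbounded_sums.
  apply/seteqP; split=> w wF.
    move=> N; have [k Nk] := natr_ub (N%:R / c); have [n _ /= kn] := wF k I.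
    exists n; apply: le_lt_trans kn.
    by rewrite mulrC -ler_pdivrMr.
  move=> N _; have [k Nk] := natr_ub (c * N%:R); have [n kn] := wF k.
  by exists n => //=; exact: le_lt_trans kn.
have : P (F n) @[n --> \oo] --> P (\bigcap_N F N).
  apply: nonincreasing_cvg_mu => //.
  - by rewrite (le_lt_trans (probability_le1 _ _))// ltry.
  - exact: bigcapT_measurable.
  - move=> m n mn; apply/subsetPset => w [k _ /= nk]; exists k => //=.
    by apply: le_lt_trans nk; rewrite ler_pM2l// ler_nat.
rewrite FA A0; apply: squeeze_cvge; last exact: cvg_cst.
apply: nearW => n; rewrite measure_ge0/=; apply: le_measure; rewrite ?inE//.
  exact: measurable_birkhoff.
move=> w /= cn; exists n => //=; exact: lt_le_trans (birkhoff_le_maxsum n w).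
Qed.

End maximal_ergodic.

(** * Shifts of two-sided paths *)

Section paths_measurability.
Context d (T : measurableType d).

Lemma measurable_coord (t : int) :
  measurable_fun setT (fun w : paths T => w t).
Proof.
move=> _ B mB; rewrite setTI; apply: sub_sigma_algebra; exists t, B; split=> //.
Qed.

Lemma measurable_paths d' (Om : measurableType d') (F : Om -> paths T) :
  (forall t, measurable_fun setT (fun w => F w t)) -> measurable_fun setT F.
Proof.
move=> mF; apply: (@measurability _ _ Om (paths T) setT F (@cylinders d T) erefl).
move=> _ [_ [t [B [mB ->]]] <-].
exact: mF.
Qed.

Definition shiftn (k : int) (w : paths T) : paths T := fun t => w (t + k).

Lemma measurable_shiftn k : measurable_fun setT (shiftn k).
Proof. by apply: measurable_paths => t; exact: measurable_coord. Qed.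

Lemma iter_shift n (w : paths T) : iter n (@Defs.shift T) w = shiftn n%:Z w.
Proof.
elim: n w => [|n IH] w; apply/funext => t; rewrite /shiftn ?addr0//=.
by rewrite IH /Defs.shift /shiftn -addn1 PoszD addrAC addrA.
Qed.

Context (R : realType) (P : probability (paths T) R).
Hypothesis statP : stationary_process P (fun t (w : paths T) => w t).

Lemma shift_preserving (E : set (paths T)) : measurable E ->
  P ((@Defs.shift T : paths T -> paths T) @^-1` E) = P E.
Proof. exact: statP. Qed.

Lemma shiftn_preserving k (E : set (paths T)) : measurable E ->
  P (shiftn k @^-1` E) = P E.
Proof.
have pos (n : nat) F : measurable F -> P (shiftn n%:Z @^-1` F) = P F.
  elim: n F => [|n IH] F mF.
    by congr (P _); apply/funext => w; congr (F _); apply/funext => t; rewrite /shiftn addr0.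
  rewrite -[RHS]IH// -(shift_preserving (E := shiftn n%:Z @^-1` F)); last first.
    by rewrite -[X in measurable X]setTI; exact: measurable_shiftn.
  congr (P _); apply/funext => w; rewrite /preimage/= -!iter_shift.
  by rewrite iterSr.
case: k => n mE; first exact: pos.
rewrite -[LHS](pos n.+1); last first.
  by rewrite -[X in measurable X]setTI; exact: measurable_shiftn.
congr (P _); apply/funext => w; rewrite /preimage/=; congr (E _).
by apply/funext => t; rewrite /shiftn NegzE addrNK.
Qed.

(** Negative shifts are included: densities given the infinite past involve the
    observations at all negative times. *)
Lemma ae_shiftn (Q : set (paths T)) :
  {ae P, forall w, Q w} -> {ae P, forall w k, Q (shiftn k w)}.
Proof.
move=> [N [mN N0 QN]].
have aek k : {ae P, forall w, Q (shiftn k w)}.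
  exists (shiftn k @^-1` N); split; last by move=> w /= /QN.
    by rewrite -[X in measurable X]setTI; exact: measurable_shiftn.
  by rewrite -N0; exact: shiftn_preserving.
have p := ae_foralln (fun n => aek n%:Z).
have m := ae_foralln (fun n => aek (Negz n)).
by apply: filterS2 p m => w p m [n|n].
Qed.

End paths_measurability.

(** * Ergodic averages of functionals of the observations *)

Section observed_ergodicity.
Context (R : realType) (h : nat) (X : set 'rV[R]_h) (x0 : X).
Context (S : {fset R}) (s0 : S).
Local Notation XX := (obs x0).
Local Notation SS := (hid s0).
Context (P : probability (paths (XX * SS)%type) R).
Hypothesis statP : stationary_process P (fun t (w : paths (XX * SS)%type) => w t).
Hypothesis ergP : ergodic_process P (fun t w => Xc t w).

(** A measurable section of the projection to the observed path.  It makes a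
    functional of the observed path that is measurable for the full process
    measurable for the observations alone, which is where ergodicity holds. *)
Definition const_state (x : paths XX) : paths (XX * SS)%type := fun t => (x t, s0).

Lemma measurable_const_state : measurable_fun setT const_state.
Proof.
apply: measurable_paths => t; apply/measurable_fun_pairP; split.
  exact: measurable_coord.
exact: measurable_cst.
Qed.

Context (f : paths (XX * SS)%type -> R) (mf : measurable_fun setT f).
Hypothesis intf : P.-integrable setT (EFin \o f).
Local Notation Om := (paths (XX * SS)%type).
Definition obs_path (w : Om) : paths XX := fun t => Xc t w.
Hypothesis fX : forall w : Om, f (const_state (obs_path w)) = f w.

Local Notation sh := (@Defs.shift (XX * SS) : paths (XX * SS)%type -> paths (XX * SS)%type).

Lemma measurable_shift : measurable_fun setT sh.
Proof. exact: (measurable_shiftn 1). Qed.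

Lemma maxsum_observed n (w : Om) : maxsum sh f n (const_state (obs_path w)) = maxsum sh f n w.
Proof. by elim: n w => //= n IH w; rewrite fX -(IH (sh w)). Qed.

Lemma observed_weak_lln (c : R) : (\int[P]_w (f w)%:E < 0)%E -> 0 < c ->
  P [set w | c * n%:R < \sum_(1 <= t < n.+1) f (shiftn t%:Z w)] @[n --> \oo] --> 0%E.
Proof.
move=> f0 c0.
have preserv := shift_preserving statP.
have A01 : P (unbounded_sums sh f) = 0%E \/ P (unbounded_sums sh f) = 1%E.
  have CE : [set w | (const_state @^-1` unbounded_sums sh f) (obs_path w)] = unbounded_sums sh f.
    apply/seteqP; split=> w /= wA N; have [n] := wA N; exists n; move: p.
      by rewrite maxsum_observed.
    by rewrite maxsum_observed.
  rewrite -CE; apply: ergP.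
    rewrite -[X in measurable X]setTI; apply: measurable_const_state => //.
    exact: (measurable_unbounded measurable_shift mf).
  by rewrite -[in RHS](unbounded_inv sh f).
have E n : P [set w | c * n%:R < \sum_(1 <= t < n.+1) f (shiftn t%:Z w)] =
    P [set w | c * n%:R < \sum_(0 <= i < n) f (iter i sh w)].
  rewrite -[RHS]preserv; last exact: (measurable_birkhoff measurable_shift mf).
  congr (P _); apply/funext => w /=; congr (is_true (_ < _)).
  rewrite big_add1/=; apply: eq_bigr => i _; congr (f _).
  by rewrite -iterSr iter_shift.
rewrite (funext E).
exact: (weak_lln_lt0 measurable_shift preserv mf intf A01 f0 c0).
Qed.

End observed_ergodicity.

(** * The parameter space *)

Lemma continuous_euclid_norm (R : realType) n : continuous (@euclid_norm R n).
Proof.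
have csq : continuous (fun v : 'rV[R]_n => \sum_(i < n) v ord0 i ^+ 2).
  apply: continuous_big => [|i _ v]; first exact: add_continuous.
  by apply: (@continuous_comp _ _ _ (fun v : 'rV[R]_n => v ord0 i) (fun y : R => y ^+ 2));
    [exact: coord_continuous|exact: exprn_continuous].
by move=> v; apply: continuous_comp (csq v) (@sqrt_continuous R _).
Qed.

Lemma euclid_normN (R : realType) n (v : 'rV[R]_n) : euclid_norm (- v) = euclid_norm v.
Proof. by rewrite /euclid_norm; congr Num.sqrt; apply: eq_bigr => i _; rewrite mxE sqrrN. Qed.

Lemma euclid_norm0 (R : realType) n : euclid_norm (0 : 'rV[R]_n) = 0.
Proof. by rewrite /euclid_norm big1 ?sqrtr0// => i _; rewrite mxE expr0n. Qed.

Section parameter_space.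
Context (R : realType) (q : nat) (Theta : set 'rV[R]_q).
Hypothesis Theta_compact : compact Theta.

Lemma finite_subcover (V : Theta -> set Theta) : (forall th, nbhs th (V th)) ->
  exists s : seq Theta, forall th, exists2 th0, th0 \in s & V th0 th.
Proof.
move=> nV.
have openV (th : Theta) : exists W : set 'rV[R]_q,
    [/\ open W, W (val th) & forall th', W (val th') -> V th th'].
  by case: (nV th) => _ [] [W oW <-] /= Wth sWV; exists W.
have [W WP] := choice openV.
have := Theta_compact; rewrite compact_cover.
move=> /(_ Theta setT (fun th => W th)) [th _|v Tv|D _ cD].
- by case: (WP th).
- by exists (exist _ v (mem_set Tv)) => //; case: (WP (exist _ v (mem_set Tv))).
exists D => th; have [th0 th0D Wth0] := cD (val th) (set_valP th).
by exists th0 => //; case: (WP th0) => _ _; exact.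
Qed.

Lemma nbhs_Theta_ball (delta : R) (th0 : Theta) : 0 < delta ->
  nbhs th0 (Theta_ball delta th0).
Proof.
move=> d0.
have cf : continuous (fun th : Theta => euclid_norm (val th0 - val th)).
  move=> th; apply: (@continuous_comp _ _ _ (fun th : Theta => val th0 - val th)
    (@euclid_norm R q)); last exact: continuous_euclid_norm.
  have cval : (val : Theta -> 'rV[R]_q) @ th --> val th by exact: initial_continuous.
  exact: (cvgB (cvg_cst (val th0)) cval).
have := cf th0; rewrite /continuous_at subrr euclid_norm0 => /cvgr_lt /(_ _ d0).
exact.
Qed.

Lemma Theta_ball_center (delta : R) (th0 : Theta) : 0 < delta -> Theta_ball delta th0 th0.
Proof. by rewrite /Theta_ball/= subrr euclid_norm0. Qed.

Lemma Theta_dist_le (eps : R) (A : set Theta) (th0 th : Theta) :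
  A th0 -> Theta_ball eps th0 th -> (`|Theta_dist th A| <= eps%:E)%E.
Proof.
move=> Ath0; rewrite /Theta_ball/= => lt_eps.
have d0 : (0 <= Theta_dist th A)%E.
  by apply: le_ereal_inf_tmp => _ [th' _ <-]; rewrite lee_fin sqrtr_ge0.
rewrite gee0_abs//; apply: (@le_trans _ _ (euclid_norm (val th - val th0))%:E).
  by apply: ereal_inf_lbound; exists th0.
by rewrite lee_fin -opprB euclid_normN ltW.
Qed.

Lemma seq_argmin (I : eqType) (f : I -> \bar R) (s : seq I) i0 : i0 \in s ->
  exists2 i, i \in s & forall j, j \in s -> (f i <= f j)%E.
Proof.
elim: s i0 => // a s IH i0 _; case: s IH => [|b s] IH.
  by exists a; rewrite ?mem_head// => j; rewrite inE => /eqP ->.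
have [i i_s imin] := IH b (mem_head _ _).
have [ai|ia] := leP (f a) (f i).
  exists a; rewrite ?mem_head// => j; rewrite inE => /orP[/eqP->//|/imin].
  exact: le_trans.
exists i; first by rewrite inE i_s orbT.
by move=> j; rewrite inE => /orP[/eqP->|/imin//]; exact: ltW.
Qed.

(** If every [t] had a strictly better [g t], lower semicontinuity would make
    [g t] beat a neighbourhood of [t]; among the finitely many [g t] of a
    subcover the best one would be beaten by another. *)
Lemma argmin_neq0 (H : Theta -> \bar R) (th : Theta) :
  lower_semicontinuous H -> exists th', argmin H th'.
Proof.
move=> lscH; apply: contrapT => /forallNP noargmin.
have better t : exists t', (H t' < H t)%E.
  have /existsNP[t' /negP] := noargmin t; rewrite -ltNge => ?.
  by exists t'.
have [g gP] := choice better.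
have sep t : exists V, nbhs t V /\ forall y, V y -> (H (g t) < H y)%E.
  have [a /andP[ga aH]] : exists a : R, (H (g t) <= a%:E < H t)%E.
    have := gP t; case: (H (g t)) => [r||]; case: (H t) => [r'||]//; rewrite ?ltxx//.
    - by move=> lt; exists r; rewrite lexx.
    - by move=> lt; exists r; rewrite lexx.
    - by move=> _; exists (r' - 1); rewrite leNye/= lte_fin; lra.
    - by move=> _; exists 0; rewrite leNye ltry.
  have [V nV VH] := lscH t a aH.
  by exists V; split=> // y /VH; exact: le_lt_trans.
have [V VP] := choice sep.
have [s sP] := finite_subcover (fun t => (VP t).1).
have [i0 i0s _] := sP th.
have [i i_s imin] := seq_argmin (H \o g) i0s.
have [j js /(VP j).2] := sP (g i).
by rewrite ltNge imin.
Qed.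

End parameter_space.

(** * Real versions of extended integrable functions *)

Section real_versions.
Context d (Om : measurableType d) (R : realType) (P : probability Om R).
Local Open Scope ereal_scope.

Lemma integrable_fine (f : Om -> \bar R) : P.-integrable setT f ->
  P.-integrable setT (EFin \o (fine \o f)) /\
  \int[P]_w (fine (f w))%:E = \int[P]_w f w.
Proof.
move=> intf; have mf : measurable_fun setT f by case/integrableP: intf.
have mfine : measurable_fun setT (fun w => (fine (f w))%:E).
  by apply/measurable_EFinP; apply: measurableT_comp => //; exact: measurable_fine.
split.
  apply: (le_integrable measurableT mfine _ intf) => w _ /=.
  by case: (f w) => [r||] //=; rewrite normr0 leey.
apply: ae_eq_integral => //.
apply: filterS (integrable_ae measurableT intf) => w fw _.
by rewrite fineK// fw.
Qed.

(** Cutting the positive part of [f] at a large constant keeps the integral above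
    [a] by monotone convergence and makes [f] integrable even when its integral
    is infinite.  The real version is a function [phi] of the value of [f], so
    that it factors through the same data as [f]. *)
Lemma truncated_below_integral (f : Om -> \bar R) (a : R) :
  measurable_fun setT f -> \int[P]_w f^\- w < +oo -> a%:E < \int[P]_w f w ->
  exists phi : \bar R -> R,
    [/\ P.-integrable setT (EFin \o (phi \o f)),
        a%:E < \int[P]_w (phi (f w))%:E & forall r, (phi r%:E <= r)%R].
Proof.
move=> mf fneg; rewrite integralE => a_lt.
have mneg : measurable_fun setT f^\- by exact: measurable_funeneg.
have mpos : measurable_fun setT f^\+ by exact: measurable_funepos.
have ineg : P.-integrable setT f^\-.
  apply/integrableP; split=> //.
  by under eq_integral do rewrite gee0_abs//.
have negfin := integrable_fin_num measurableT ineg.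
pose u (n : nat) w := mine (f^\+ w) n%:R%:E.
have u0 n w : 0 <= u n w by rewrite le_min funepos_ge0 lee_fin/=.
have mu n : measurable_fun setT (u n).
  by apply: measurable_mine => //; exact: measurable_cst.
have limu w : limn (u^~ w) = f^\+ w.
  apply/cvg_lim => //; have := funepos_ge0 f w; rewrite /u.
  case: (f^\+ w) => [r r0|_|//].
    apply: cvg_near_cst; exists (Num.bound r) => // n /= rn.
    apply/min_idPl; rewrite lee_fin; apply/ltW/(lt_le_trans (archi_boundP r0)).
    by rewrite ler_nat.
  rewrite (_ : (fun n => _) = (fun n : nat => n%:R%:E)); last first.
    by apply/funext => n; apply/min_idPr; rewrite leey.
  by apply/cvgeryP/cvgryPge => M; exists (Num.bound `|M|) => //= m /= Mm;
    rewrite (le_trans (ler_norm M))// (le_trans (ltW (archi_boundP _)))// ler_nat.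
have nd w : setT w -> nondecreasing_seq (u^~ w).
  by move=> _ m n mn; rewrite /u le_min !ge_min lexx/= lee_fin ler_nat mn orbT.
have cvu : \int[P]_w u n w @[n --> \oo] --> \int[P]_w f^\+ w.
  rewrite (_ : f^\+ = fun w => limn (u^~ w)); last first.
    by apply/funext => w; rewrite limu.
  exact: (cvg_monotone_convergence measurableT mu (fun n w _ => u0 n w) nd).
have [n an] : exists n, a%:E < \int[P]_w u n w - \int[P]_w f^\- w.
  apply: contrapT => /forallNP noN; move: a_lt; rewrite ltNge => /negP; apply.
  rewrite leeBlDr// -(cvg_lim _ cvu)//; apply: lime_le; first exact: cvgP cvu.
  by apply: nearW => n; have /negP := noN n; rewrite -leNgt leeBlDr.
have iun : P.-integrable setT (u n).
  have icst : P.-integrable setT (EFin \o cst (n%:R : R)).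
    exact: finite_measure_integrable_cst.
  apply: (le_integrable measurableT (mu n) _ icst) => w _.
  by rewrite gee0_abs// [leRHS]gee0_abs/= ?lee_fin// /u ge_min lexx orbT.
pose phi (y : \bar R) : R :=
  (fine (mine (maxe y 0%E) n%:R%:E) - fine (maxe (- y)%E 0%E))%R.
have phiE w : (fine (u n w))%:E - (fine (f^\- w))%:E = (phi (f w))%:E.
  by rewrite /phi /u funeposE funenegE EFinB.
have [iu Eu] := integrable_fine iun; have [im Em] := integrable_fine ineg.
exists phi; split.
- by have := integrableB measurableT iu im; apply: eq_integrable => // w _; exact: phiE.
- under eq_integral do rewrite -phiE.
  by rewrite (integralB measurableT iu im) Eu Em.
- move=> r; rewrite /phi -EFinN -!EFin_max -EFin_min /=.
  rewrite lerBlDr ge_min; apply/orP; left.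
  rewrite !maxEle oppr_le0.
  by case: ifPn; case: ifPn => *; lra.
Qed.

End real_versions.

(** * Outer probability *)

Section outer_probability.
Context d (Om : measurableType d) (R : realType) (P : probability Om R).
Local Open Scope ereal_scope.

Lemma mu_extU (A B : set Om) : mu_ext P (A `|` B) <= mu_ext P A + mu_ext P B.
Proof. exact: (outer_measureU2 (mu_ext P)). Qed.

Lemma mu_ext_ae (Q : set Om) : {ae P, forall w, Q w} -> mu_ext P (~` Q) = 0.
Proof.
move=> [N [mN N0 QN]]; apply/eqP; rewrite eq_le; apply/andP; split.
  by rewrite -N0 -(measurable_mu_extE P mN); apply: le_mu_ext.
exact: mu_ext_ge0.
Qed.

Lemma mu_ext_seqU_cvg0 (I : eqType) (Q : set I) (A : I -> nat -> set Om) (s : seq I) :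
  (forall i, Q i -> mu_ext P (A i n) @[n --> \oo] --> 0) ->
  mu_ext P [set w | exists i, [/\ i \in s, Q i & A i n w]] @[n --> \oo] --> 0.
Proof.
move=> A0; elim: s => [|a s IH].
  rewrite (_ : (fun n => _) = cst 0); first exact: cvg_cst.
  apply/funext => n; rewrite (_ : [set w | _] = set0); first exact: outer_measure0.
  by rewrite -subset0 => w [i []].
have Aa0 : mu_ext P [set w | Q a /\ A a n w] @[n --> \oo] --> 0.
  have [Qa|nQa] := pselect (Q a).
    apply: squeeze_cvge (A0 a Qa); last exact: cvg_cst.
    apply: nearW => n; apply/andP; split; first exact: outer_measure_ge0.
    by apply: le_mu_ext => w [].
  rewrite (_ : (fun n => _) = cst 0); first exact: cvg_cst.
  apply/funext => n; rewrite (_ : [set w | _] = set0); first exact: outer_measure0.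
  by rewrite -subset0 => w [].
have sum0 : (mu_ext P [set w | Q a /\ A a n w] +
    mu_ext P [set w | exists i, [/\ i \in s, Q i & A i n w]]) @[n --> \oo] --> 0.
  by rewrite -[X in _ --> X]adde0; exact: cvgeD.
apply: squeeze_cvge sum0; last exact: cvg_cst.
apply: nearW => n; apply/andP; split; first exact: outer_measure_ge0.
apply: le_trans (mu_extU _ _); apply: le_mu_ext => w [i [+ Qi Ai]].
by rewrite inE => /orP[/eqP <-|i_s]; [left|right; exists i].
Qed.

End outer_probability.

(** * Wald's argument *)

(** With [a] and [b] the sums of stationary log-densities at the estimate and at
    the reference parameter, [f] the forgetting error and [e] the slack of the
    maximizer: the constants leave [c - c / 8 - 2 * c / 8 > c / 2]. *)
Lemma contrast_gap (R : realFieldType) (T c e l ls a b f con : R) :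
  0 < T -> 0 < c -> e < c / 8 -> ls - e <= l ->
  `|T * l - a| <= f -> `|T * ls - b| <= f -> f <= c / 8 * T ->
  a - b <= con - c * T -> c / 2 * T < con.
Proof.
rewrite !ler_norml => T0 c0 ec le_l /andP[l1 l2] /andP[ls1 ls2] fc ab.
have h1 : T * (ls - e) <= T * l by rewrite ler_pM2l.
have h2 : T * e <= T * (c / 8) by rewrite ler_pM2l// ltW.
have h3 : 0 < c * T by rewrite mulr_gt0.
rewrite mulrBr in h1; lra.
Qed.

Lemma negative_mean (R : realFieldType) (u v w c : R) :
  0 < c -> u <= 1 + c -> w + c *+ 3 < v -> u - (1 - c) - v + w < 0.
Proof. by move=> *; lra. Qed.

Lemma contrast_step (R : realFieldType) (a a0 a1 b u v c : R) :
  v <= b - a0 -> a - a0 <= u - 1 -> a - a1 <= u - (1 - c) - v + (b - a1) - c.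
Proof. by move=> *; lra. Qed.

Section consistency.
Context (R : realType) (h : nat) (X : set 'rV[R]_h) (x0 : X).
Context (S : {fset R}) (s0 : S).
Local Notation XX := (obs x0).
Local Notation SS := (hid s0).
Local Notation Om := (paths (XX * SS)%type).
Context (nuS : XX -> SS -> R).
Hypothesis nuS_ge0 : forall y s, 0 <= nuS y s.
Hypothesis nuS_sum1 : forall y, \sum_(s : SS) nuS y s = 1.
Context (qlow : XX -> R) (qlow_gt0 : forall y, 0 < qlow y).
Context (C : XX -> XX -> R).

Definition forgetting_bound (w : Om) (t : nat) : R :=
  Num.max 1 (C (Xc (t%:Z - 1) w) (Xc t%:Z w)) *
  \prod_(0 <= i < t) (1 - qlow (Xc i%:Z w)).

(** Log-density of the observation at time [0] given the infinite past; it is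
    evaluated along shifted paths. *)
Definition log_pred (QK : R.-pker (XX * SS) ~> SS) p (w : Om) : R :=
  ln (fine (cdens_inf nuS QK p (fun i => Xc i w) 0)).

Lemma log_pred_close (QK : R.-pker (XX * SS) ~> SS) p (w : Om) (t : nat) :
  (forall y s s', qlow y <= qmass QK y s s') -> (forall x s y, 0 <= p x s y) ->
  (forall k, (dens_ratio p (Xc k w) (Xc (k + 1) w) <= (C (Xc k w) (Xc (k + 1) w))%:E)%E) ->
  (0 < t)%N ->
  [/\ 0 < cdens nuS QK p (fun i => Xc i w) 0 t%:Z,
    exists2 l : R, 0 < l &
      cdens_inf nuS QK p (fun i => Xc i (shiftn t%:Z w)) 0 = l%:E &
    `|ln (cdens nuS QK p (fun i => Xc i w) 0 t%:Z) - log_pred QK p (shiftn t%:Z w)|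
      <= forgetting_bound w t].
Proof.
case: t => // n qQ p0 pC _; pose x i := Xc i w.
have ratio k := dens_ratioP (fun s => p0 _ s _) (pC k).
have ppos k s : 0 < p (x k) s (x (k + 1)).
  by apply: lt_le_trans (min_dens_le _ _ _ _); case: (ratio k).
have xn : x n.+1%:Z = x (n%:Z + 1) by rewrite -addn1 PoszD.
pose c := Num.max 1 (C (x n%:Z) (x n.+1%:Z)).
have c0 : 0 <= c by rewrite le_max ler01.
have maxmin : max_dens p (x n%:Z) (x n.+1%:Z) <= c * min_dens p (x n%:Z) (x n.+1%:Z).
  rewrite /c xn; case: (ratio n%:Z) => m0 /le_trans; apply.
  by rewrite ler_wpM2r ?(ltW m0)// le_max lexx orbT.
have [c_gt0 [l [lE l0 close]]] :=
  cdens_inf_close qlow_gt0 qQ nuS_ge0 nuS_sum1 ppos c0 maxmin.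
split=> //; first by exists l.
rewrite /log_pred [cdens_inf _ _ _ _ _]lE /forgetting_bound.
have -> : n.+1%:Z - 1 = n%:Z by rewrite -addn1 PoszD addrK.
exact: close.
Qed.

Context (q : nat) (Theta : set 'rV[R]_q).
Context (Qst : R.-pker (XX * SS) ~> SS) (pst : XX -> SS -> XX -> R).
Context (Q_ : Theta -> R.-pker (XX * SS) ~> SS) (p_ : Theta -> XX -> SS -> XX -> R).
Hypothesis Qst_ge : forall x s s', qlow x <= qmass Qst x s s'.
Hypothesis Q_ge : forall th x s s', qlow x <= qmass (Q_ th) x s s'.
Hypothesis pst_ge0 : forall x s y, 0 <= pst x s y.
Hypothesis p_ge0 : forall th x s y, 0 <= p_ th x s y.

(** The bound on the density ratios at all times, which makes every predictive
    density positive and finite along the path. *)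
Definition regular (w : Om) : Prop := forall k,
  (forall th, (dens_ratio (p_ th) (Xc k w) (Xc (k + 1) w) <= (C (Xc k w) (Xc (k + 1) w))%:E)%E) /\
  (dens_ratio pst (Xc k w) (Xc (k + 1) w) <= (C (Xc k w) (Xc (k + 1) w))%:E)%E.

Let closeM th (w : Om) t (rw : regular w) :=
  @log_pred_close (Q_ th) (p_ th) w t (Q_ge th) (p_ge0 th) (fun k => (rw k).1 th).
Let closeS (w : Om) t (rw : regular w) :=
  @log_pred_close Qst pst w t Qst_ge pst_ge0 (fun k => (rw k).2).

Lemma loglik_close (w : Om) th (T : nat) : regular w -> (0 < T)%N ->
  exists2 l : R, loglik nuS (Q_ th) (p_ th) (fun i => Xc i w) T = l%:E &
    `|T%:R * l - \sum_(1 <= t < T.+1) log_pred (Q_ th) (p_ th) (shiftn t%:Z w)|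
      <= \sum_(1 <= t < T.+1) forgetting_bound w t.
Proof.
move=> rw T0.
pose u t := ln (cdens nuS (Q_ th) (p_ th) (fun i => Xc i w) 0 t%:Z).
exists (T%:R^-1 * \sum_(1 <= t < T.+1) u t).
  rewrite /loglik EFinM -sumEFin; congr (_ * _)%E.
  rewrite big_nat [RHS]big_nat; apply: eq_bigr => t /andP[t0 _].
  by rewrite lne_EFin//; case: (closeM th rw t0).
rewrite mulrA divff ?mul1r ?pnatr_eq0 -?lt0n// -sumrB.
apply: le_trans (ler_norm_sum _ _ _) _.
rewrite big_nat [leRHS]big_nat; apply: ler_sum => t /andP[t0 _].
by case: (closeM th rw t0).
Qed.

Local Notation g := (log_ratio nuS Qst pst Q_ p_).
Local Notation SR := (sup_ratio nuS Q_ p_).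

Lemma log_ratio_regular (w : Om) th t : regular w -> (0 < t)%N ->
  g th (shiftn t%:Z w) =
    (log_pred Qst pst (shiftn t%:Z w) - log_pred (Q_ th) (p_ th) (shiftn t%:Z w))%:E.
Proof.
move=> rw t0; case: (closeM th rw t0) => _ [l l0 lE] _.
case: (closeS rw t0) => _ [l' l'0 l'E] _.
rewrite /log_ratio /log_pred [cdens_inf _ _ _ _ _ in X in (X / _)%E]l'E
  [cdens_inf _ (Q_ th) _ _ _]lE [cdens_inf _ Qst _ _ _]l'E /=.
by rewrite inver gt_eqF// -EFinM lne_EFin ?divr_gt0// ln_div.
Qed.

Lemma sup_ratio_regular (w : Om) delta th0 th t : regular w -> (0 < t)%N ->
  Theta_ball delta th0 th -> SR delta th0 (shiftn t%:Z w) \is a fin_num ->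
  log_pred (Q_ th) (p_ th) (shiftn t%:Z w) - log_pred (Q_ th0) (p_ th0) (shiftn t%:Z w)
    <= fine (SR delta th0 (shiftn t%:Z w)) - 1.
Proof.
move=> rw t0 ball SRfin; case: (closeM th rw t0) => _ [l l0 lE] _.
case: (closeM th0 rw t0) => _ [l' l'0 l'E] _.
rewrite /log_pred [cdens_inf _ (Q_ th) _ _ _]lE [cdens_inf _ (Q_ th0) _ _ _]l'E /=.
have SRge : l / l' <= fine (SR delta th0 (shiftn t%:Z w)).
  rewrite -lee_fin fineK//; apply: ereal_sup_ubound; exists th => //.
  rewrite [cdens_inf _ (Q_ th) _ _ _]lE [cdens_inf _ (Q_ th0) _ _ _]l'E.
  by rewrite inver gt_eqF// -EFinM.
rewrite -ln_div//; have ll' : 0 < l / l' by exact: divr_gt0.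
rewrite -[l / l'](subrKC 1); apply: le_trans (le_ln1Dx _) _; lra.
Qed.

Context (Pbar : probability Om R).
Hypothesis statP : stationary_process Pbar (fun t (w : Om) => w t).
Hypothesis ergP : ergodic_process Pbar (fun t w => Xc t w).
Hypothesis ratio_le : {ae Pbar, forall w,
  (ereal_sup [set dens_ratio (p_ th) (Xc 0 w) (Xc 1 w) | th in [set: Theta]]
     <= (C (Xc 0 w) (Xc 1 w))%:E)%E /\
  (dens_ratio pst (Xc 0 w) (Xc 1 w) <= (C (Xc 0 w) (Xc 1 w))%:E)%E}.

Lemma ae_regular : {ae Pbar, forall w, regular w}.
Proof.
apply: filterS (ae_shiftn statP ratio_le) => w rw k.
have [] := rw k; rewrite /Xc /shiftn add0r addrC => sup_le st_le; split=> // th.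
by apply: le_trans sup_le; apply: ereal_sup_ubound; exists th.
Qed.

Hypothesis H_exists : Hstar_exists Pbar nuS Qst pst Q_ p_.
Local Notation H := (Hstar Pbar nuS Qst pst Q_ p_).

(** A finite criterion value turns the one-sided integrability of the log ratio
    into integrability. *)
Lemma log_ratio_integrable th : (H th < +oo)%E -> Pbar.-integrable setT (g th).
Proof.
move=> Hfin; have [mg gneg] := H_exists th.
have mpos : measurable_fun setT ((g th)^\+)%E by exact: measurable_funepos.
have mneg : measurable_fun setT ((g th)^\-)%E by exact: measurable_funeneg.
apply/integrableP; split=> //.
have -> : (fun w => `|g th w|)%E = ((g th)^\+ \+ (g th)^\-)%E by rewrite -fune_abse.
rewrite ge0_integralD// lte_add_pinfty//.
have negfin : (\int[Pbar]_w (g th)^\- w)%E \is a fin_num.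
  by rewrite ge0_fin_numE// integral_ge0.
have : (\int[Pbar]_w (g th)^\+ w - \int[Pbar]_w (g th)^\- w < +oo)%E.
  by rewrite -integralE.
by rewrite lteBlDr// => /lt_le_trans; apply; exact: leey.
Qed.

(** The slack [c] in the constant term leaves room for the forgetting error and
    the slack of the approximate maximizer. *)
Definition contrast (phi : \bar R -> R) delta c th0 ths (w : Om) : R :=
  fine (SR delta th0 w) - (1 - c) - phi (g th0 w) + fine (g ths w).

Lemma contrast_integral phi delta c th0 ths :
  Pbar.-integrable setT (SR delta th0) ->
  Pbar.-integrable setT (EFin \o (phi \o g th0)) ->
  Pbar.-integrable setT (g ths) ->
  Pbar.-integrable setT (EFin \o contrast phi delta c th0 ths) /\
  (\int[Pbar]_w (contrast phi delta c th0 ths w)%:E =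
   \int[Pbar]_w SR delta th0 w - (1 - c)%:E - \int[Pbar]_w (phi (g th0 w))%:E + H ths)%E.
Proof.
move=> iSR iphi ig.
have [i1 E1] := integrable_fine iSR; have [i2 E2] := integrable_fine ig.
have ic : Pbar.-integrable setT (EFin \o cst (1 - c)).
  exact: finite_measure_integrable_cst.
have i3 := integrableB measurableT i1 ic.
have i4 := integrableB measurableT i3 iphi.
have i5 := integrableD measurableT i4 i2.
split; first exact: i5.
rewrite /Hstar -E1 -E2 -[(1 - c)%:E](_ : \int[Pbar]_w (EFin \o cst (1 - c)%R) w = _)%E.
  rewrite -(integralB measurableT i1 ic) -(integralB measurableT i3 iphi).
  by rewrite -(integralD measurableT i4 i2).
by have := integral_cst Pbar measurableT (1 - c)%:E; rewrite [X in (_ * X)%E](@probability_setT _ _ _ Pbar) mule1.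
Qed.

Hypothesis sup_ratio_le : forall eps : R, 0 < eps -> exists2 delta : R, 0 < delta &
  forall th0 : Theta,
    measurable_fun setT (SR delta th0) /\
    (\int[Pbar]_w SR delta th0 w <= (1 + eps)%:E)%E.

Lemma cdens_inf_ge0 (QK : R.-pker (XX * SS) ~> SS) p x : (forall x s s', 0 <= qmass QK x s s') ->
  (forall x s y, 0 <= p x s y) -> (0 <= cdens_inf nuS QK p x 0)%E.
Proof.
move=> Q0 p0.
have lik0 m k : 0 <= likelihood nuS QK p x m k.
  by apply: sumr_ge0 => s _; rewrite mulr_ge0// prodr_ge0// => i _; rewrite mulr_ge0.
have /(@limn_einf_bounds _ _ _ +oo%E 0) /andP[] // : forall M, (0 <= M)%N ->
    (0 <= (cdens nuS QK p x (- M%:Z) 0)%:E <= +oo)%E.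
  by move=> M _; rewrite leey lee_fin divr_ge0.
Qed.

Lemma sup_ratio_integrable delta th0 c : 0 < delta ->
  measurable_fun setT (SR delta th0) -> (\int[Pbar]_w SR delta th0 w <= c%:E)%E ->
  Pbar.-integrable setT (SR delta th0).
Proof.
move=> d0 mSR SRc; apply/integrableP; split=> //.
have SR0 w : (0 <= SR delta th0 w)%E.
  apply: le_trans (ereal_sup_ubound _); last first.
    by exists th0 => //; exact: Theta_ball_center.
  have Q0 x s s' : 0 <= qmass (Q_ th0) x s s'.
    exact: le_trans (ltW (qlow_gt0 x)) (Q_ge th0 x s s').
  by rewrite mule_ge0 ?inve_ge0 ?cdens_inf_ge0.
under eq_integral do rewrite gee0_abs//.
by apply: le_lt_trans SRc _; rewrite ltry.
Qed.

(** The supremum ratio has mean at most [1 + c], and the truncated log ratio at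
    [th0] exceeds in mean the log ratio at [ths] by [3 * c]; with the slack the
    mean of the contrast is below [2 * c - 3 * c]. *)
Lemma exists_contrast th0 ths : argmin H ths -> ~ argmin H th0 ->
  exists (c delta : R) (phi : \bar R -> R),
    [/\ 0 < c, 0 < delta & forall r, phi r%:E <= r] /\
    [/\ Pbar.-integrable setT (SR delta th0),
     Pbar.-integrable setT (EFin \o contrast phi delta c th0 ths) &
     (\int[Pbar]_w (contrast phi delta c th0 ths w)%:E < 0)%E].
Proof.
move=> ths_min /existsNP[th' /negP]; rewrite -ltNge => H'0.
have Hlt : (H ths < H th0)%E by exact: le_lt_trans (ths_min th') H'0.
have ig := log_ratio_integrable (lt_le_trans Hlt (leey _)).
have Hfin : H ths \is a fin_num by exact: integrable_fin_num ig.
have [c c0 cH] : exists2 c : R, 0 < c & ((fine (H ths) + c *+ 3)%:E < H th0)%E.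
  move: Hlt; rewrite -(fineK Hfin); case: (H th0) => [r||]//=.
    rewrite lte_fin => lt; exists ((r - fine (H ths)) / 4); first lra.
    rewrite lte_fin; lra.
  by move=> _; exists 1; rewrite ?ltry.
have [delta d0 SRle] := sup_ratio_le c0.
have [mSR SRc] := SRle th0.
have [mg gneg] := H_exists th0.
have [phi [iphi phi_lt phi_le]] := truncated_below_integral mg gneg cH.
have iSR := sup_ratio_integrable d0 mSR SRc.
have [icon Econ] := contrast_integral c iSR iphi ig.
exists c, delta, phi; split=> //; split=> //; rewrite Econ.
have SRfin := integrable_fin_num measurableT iSR.
have phifin := integrable_fin_num measurableT iphi.
move: SRc phi_lt; rewrite -(fineK SRfin) -(fineK phifin) -(fineK Hfin).
rewrite !lee_fin !lte_fin /=.
exact: negative_mean c0.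
Qed.

Context (eta : nat -> R) (eta_cvg : eta @ \oo --> (0 : R)).
Context (that : estimator x0 Theta).
Hypothesis thatE : approx_maximizer Pbar nuS Q_ p_ eta that.
Hypothesis mixing : oP1 Pbar (fun (T : nat) w =>
  (T%:R^-1 * \sum_(1 <= t < T.+1) forgetting_bound w t)%:E).

Definition near_max T (w : Om) : Prop :=
  (ereal_sup [set loglik nuS (Q_ th) (p_ th) (fun i => Xc i w) T | th in [set: Theta]]
     - (eta T)%:E
   <= loglik nuS (Q_ (estimate that T w)) (p_ (estimate that T w))
        (fun i => Xc i w) T)%E.

(** If the estimate is in the ball although the path is regular and the forgetting
    error is small, then near-maximality forces the sum of the contrasts above
    [c / 2 * T], which the law of large numbers excludes. *)
Lemma estimator_avoids th0 ths : argmin H ths -> ~ argmin H th0 ->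
  exists2 delta : R, 0 < delta &
    mu_ext Pbar [set w | Theta_ball delta th0 (estimate that T w)] @[T --> \oo] --> 0%E.
Proof.
move=> ths_min th0_nmin.
have [c [delta [phi [[c0 d0 phi_le] [iSR icon con_lt0]]]]] := exists_contrast ths_min th0_nmin.
exists delta; first exact: d0.
pose con := contrast phi delta c th0 ths.
have mcon : measurable_fun setT con.
  by apply/measurable_EFinP; case/integrableP: icon.
have bad0 : Pbar [set w | c / 2 * T%:R < \sum_(1 <= t < T.+1) con (shiftn t%:Z w)]
    @[T --> \oo] --> 0%E.
  have c2 : 0 < c / 2 by rewrite divr_gt0.
  have conX (w : Om) : con (const_state s0 (obs_path w)) = con w by [].
  exact: (observed_weak_lln statP ergP mcon icon conX con_lt0 c2).
have c8 : 0 < c / 8 by rewrite divr_gt0.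
have mix0 := mixing c8.
have SRfin : {ae Pbar, forall w k, SR delta th0 (shiftn k w) \is a fin_num}.
  have SRfin0 : {ae Pbar, forall w, SR delta th0 w \is a fin_num}.
    apply: filterS (integrable_ae measurableT iSR) => w SRw; exact: (SRw I).
  exact: (@ae_shiftn _ _ _ Pbar statP [set w | SR delta th0 w \is a fin_num] SRfin0).
pose G T : set Om := [set w | [/\ regular w,
  forall k, SR delta th0 (shiftn k w) \is a fin_num & near_max T w]].
have good T : (0 < T)%N -> {ae Pbar, forall w, G T w}.
  move=> T0; apply: filterS3 ae_regular SRfin (thatE T0) => w rw SRw mw.
  by split; [exact: rw|exact: SRw|exact: mw].
have main : \forall T \near \oo, forall w, G T w ->
   Theta_ball delta th0 (estimate that T w) ->
   T%:R^-1 * \sum_(1 <= t < T.+1) forgetting_bound w t <= c / 8 ->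
   c / 2 * T%:R < \sum_(1 <= t < T.+1) con (shiftn t%:Z w).
  have eta_lt : \forall T \near \oo, eta T < c / 8 by exact: (cvgr_lt _ eta_cvg).
  near=> T => w [rw SRw max_w] ball_w mix_w.
  have T0 : (0 < T)%N by near: T; exists 1%N.
  have TR : 0 < T%:R :> R by rewrite ltr0n.
  have etaT : eta T < c / 8 by near: T.
  have [l lE l_close] := loglik_close (estimate that T w) rw T0.
  have [ls lsE ls_close] := loglik_close ths rw T0.
  have lle : ls - eta T <= l.
    rewrite -lee_fin -lE; apply: le_trans max_w; rewrite EFinB; apply: leeD2r.
    by rewrite -lsE; apply: ereal_sup_ubound; exists ths.
  have sum_le : \sum_(1 <= t < T.+1)
        log_pred (Q_ (estimate that T w)) (p_ (estimate that T w)) (shiftn t%:Z w)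
      - \sum_(1 <= t < T.+1) log_pred (Q_ ths) (p_ ths) (shiftn t%:Z w)
      <= \sum_(1 <= t < T.+1) con (shiftn t%:Z w) - c * T%:R.
    have -> : c * T%:R = \sum_(1 <= t < T.+1) c.
      by rewrite sumr_const_nat subn1 mulr_natr.
    rewrite -!sumrB big_nat [leRHS]big_nat; apply: ler_sum => t /andP[t0 _].
    move: (sup_ratio_regular rw t0 ball_w (SRw _)).
    rewrite /con /contrast !(log_ratio_regular _ rw t0)/=.
    move: (phi_le (log_pred Qst pst (shiftn t w) - log_pred (Q_ th0) (p_ th0) (shiftn t w))).
    exact: contrast_step.
  have mixT : \sum_(1 <= t < T.+1) forgetting_bound w t <= c / 8 * T%:R.
    by move: mix_w; rewrite mulrC ler_pdivrMr.
  exact: contrast_gap TR c0 etaT lle l_close ls_close mixT sum_le.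
have bad_mix0 : (Pbar [set w | (c / 2 * T%:R < \sum_(1 <= t < T.+1) con (shiftn t%:Z w))%R] +
   mu_ext Pbar [set w | (c / 8)%:E <
     `|(T%:R^-1 * \sum_(1 <= t < T.+1) forgetting_bound w t)%:E|])%E @[T --> \oo] --> 0%E.
  by rewrite -[X in _ --> X]adde0; apply: cvgeD.
apply: squeeze_cvge bad_mix0; last exact: cvg_cst.
apply: filterS2 main (nbhs_infty_gt 0%N) => T mainT T0.
set bad := [set w | (_ < _)%R]; set mix := [set w | (_ < _)%E].
have mbad : measurable bad.
  have mS : measurable_fun setT (fun w => \sum_(1 <= t < T.+1) con (shiftn t%:Z w)).
    by apply: measurable_sum => t; exact: (measurableT_comp mcon (measurable_shiftn _)).
  rewrite -[X in measurable X]setTI.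
  exact: (measurable_fun_ltr (measurable_cst (c / 2 * T%:R)) mS).
apply/andP; split; first exact: outer_measure_ge0.
have sub : [set w | Theta_ball delta th0 (estimate that T w)] `<=`
    (bad `|` mix) `|` ~` G T.
  move=> w ball_w; have [Gw|nGw] := pselect (G T w); last by right.
  left; have [le_mix|lt_mix] := leP (T%:R^-1 * \sum_(1 <= t < T.+1) forgetting_bound w t) (c / 8).
    by left; exact: mainT.
  by right; rewrite /mix/= lte_fin; exact: lt_le_trans lt_mix (ler_norm _).
apply: le_trans (le_mu_ext _ sub) _; apply: le_trans (mu_extU _ _ _) _.
rewrite (mu_ext_ae (good T T0)) adde0 -(measurable_mu_extE Pbar mbad).
exact: mu_extU.
Unshelve. all: by end_near.
Qed.

Hypothesis Theta_compact : compact Theta.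
Hypothesis H_lsc : lower_semicontinuous H.

(** The subcover uses radius at most [eps] everywhere, so an estimate at distance
    more than [eps] from the argmin falls in a ball centred outside it. *)
Lemma estimator_consistent :
  oP1 Pbar (fun T w => Theta_dist (estimate that T w) (argmin H)).
Proof.
move=> eps eps0.
have [ths ths_min] := argmin_neq0 Theta_compact (that (fun _ : 'I_1 => x0)) H_lsc.
have radius th0 : exists delta : R, 0 < delta /\ (~ argmin H th0 ->
    mu_ext Pbar [set w | Theta_ball delta th0 (estimate that T w)] @[T --> \oo] --> 0%E).
  have [th0_min|th0_nmin] := pselect (argmin H th0); first by exists 1.
  have [delta d0 cv] := estimator_avoids ths_min th0_nmin.
  exists delta; split; [exact: d0|move=> _; exact: cv].
have [delta deltaP] := choice radius.
pose V th0 := Theta_ball (Num.min eps (delta th0)) th0.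
have [th0|s sP] := finite_subcover Theta_compact (V := V).
  by apply: nbhs_Theta_ball; rewrite lt_min eps0; case: (deltaP th0).
have := @mu_ext_seqU_cvg0 _ _ _ Pbar _ (~` argmin H)
  (fun th0 T => [set w | Theta_ball (delta th0) th0 (estimate that T w)]) s
  (fun th0 => (deltaP th0).2).
move=> far0; apply: squeeze_cvge far0; last exact: cvg_cst.
apply: nearW => T; apply/andP; split; first exact: outer_measure_ge0.
apply: le_mu_ext => w /=; have [th0 th0_s] := sP (estimate that T w).
rewrite /V /Theta_ball/= lt_min => /andP[lt_eps lt_delta].
have [th0_min|th0_nmin] := pselect (argmin H th0).
  by rewrite ltNge (Theta_dist_le th0_min lt_eps).
move=> _; exists th0; split; [exact: th0_s|exact: th0_nmin|exact: lt_delta].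
Qed.

End consistency.

Theorem theorem1 (R : realType)
  (h : nat) (X : set 'rV[R]_h) (x0 : X)
  (S : {fset R}) (s0 : S)
  (mu : {sigma_finite_measure set (obs x0) -> \bar R})
  (* true kernels *)
  (Pst : R.-pker (obs x0 * hid s0) ~> obs x0)
  (Qst : R.-pker (obs x0 * hid s0) ~> hid s0)
  (pst : obs x0 -> hid s0 -> obs x0 -> R)
  (pstE : has_density mu Pst pst)
  (* model *)
  (q : nat) (Theta : set 'rV[R]_q)
  (P_ : Theta -> R.-pker (obs x0 * hid s0) ~> obs x0)
  (Q_ : Theta -> R.-pker (obs x0 * hid s0) ~> hid s0)
  (p_ : Theta -> obs x0 -> hid s0 -> obs x0 -> R)
  (p_E : forall th, has_density mu (P_ th) (p_ th))
  (* stationary law *)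
  (nu : probability (obs x0 * hid s0)%type R)
  (nuI : invariant_law Pst Qst nu)
  (nuS : obs x0 -> hid s0 -> R)
  (nuSE : cond_state_law nu nuS)
  (Pbar : probability (paths (obs x0 * hid s0)%type) R)
  (PbarE : two_sided_law Pst Qst nu Pbar)
  (* estimator *)
  (eta : nat -> R) (eta_ge0 : forall T, 0 <= eta T)
  (eta_cvg : eta @ \oo --> (0 : R))
  (that : estimator x0 Theta)
  (thatE : approx_maximizer Pbar nuS Q_ p_ eta that)
  (* (1) *)
  (qlow : obs x0 -> R)
  (qlow_cont : continuous qlow)
  (qlow_gt0 : forall x, 0 < qlow x)
  (Qst_ge : forall x s s', qlow x <= qmass Qst x s s')
  (Q_ge : forall th x s s', qlow x <= qmass (Q_ th) x s s')
  (* (2) *)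
  (lam gam b rad : R) (U : obs x0 -> R) (varpi : probability (obs x0) R)
  (lam01 : 0 < lam < 1) (gam01 : 0 < gam < 1) (b_gt0 : 0 < b)
  (rad_gt : 2 * b / (1 - gam) < rad)
  (U_lsc : lower_semicontinuous (EFin \o U))
  (U_ge1 : forall x, 1 <= U x)
  (A : set (obs x0)) (AE : A = [set x | U x <= rad])
  (drift : forall s x,
     (\int[Pst (x, s)]_x' (U x')%:E <= (gam * U x + b * \1_A x)%:E)%E)
  (A_bounded : bounded_set [set val x | x in (A : set X)])
  (A_gt0 : (0 < varpi A)%E)
  (minorization : forall s C, measurable C ->
     (lam%:E * varpi C <= ereal_inf [set Pst (x, s) C | x in A])%E)
  (* (3) *)
  (Theta_compact : compact Theta)
  (H_exists : Hstar_exists Pbar nuS Qst pst Q_ p_)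
  (H_lsc : lower_semicontinuous (Hstar Pbar nuS Qst pst Q_ p_))
  (* (4) *)
  (sup_ratio_le : forall eps : R, 0 < eps -> exists2 delta : R, 0 < delta &
     forall th0 : Theta,
       measurable_fun setT (sup_ratio nuS Q_ p_ delta th0) /\
       (\int[Pbar]_w sup_ratio nuS Q_ p_ delta th0 w <= (1 + eps)%:E)%E)
  (C : obs x0 -> obs x0 -> R) (C_ge0 : forall x y, 0 <= C x y)
  (ratio_le : {ae Pbar, forall w,
     (ereal_sup [set dens_ratio (p_ th) (Xc 0 w) (Xc 1 w) | th in [set: Theta]]
        <= (C (Xc 0 w) (Xc 1 w))%:E)%E /\
     (dens_ratio pst (Xc 0 w) (Xc 1 w) <= (C (Xc 0 w) (Xc 1 w))%:E)%E})
  (* (5) *)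
  (mixing : oP1 Pbar (fun (T : nat) w =>
     (T%:R^-1 * \sum_(1 <= t < T.+1)
        Num.max 1 (C (Xc (t%:Z - 1) w) (Xc t%:Z w)) *
        \prod_(0 <= i < t) (1 - qlow (Xc i%:Z w)))%:E)) :
  oP1 Pbar (fun T w =>
    Theta_dist (estimate that T w) (argmin (Hstar Pbar nuS Qst pst Q_ p_))).
Proof.
have [nuS_ge0 nuS_sum1 _ _] := nuSE; have [statP ergP _ _ _] := PbarE.
have [pst_ge0 _ _] := pstE.
have p_ge0 th : forall x s y, 0 <= p_ th x s y by case: (p_E th).
exact: (estimator_consistent nuS_ge0 nuS_sum1 qlow_gt0 Qst_ge Q_ge pst_ge0 p_ge0
  statP ergP ratio_le H_exists sup_ratio_le eta_cvg thatE mixing Theta_compact H_lsc).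
Qed.
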